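(* Suppose that the utility fields $U_1,\dots,U_M$ satisfy the Assumption on utilities given in the context, that the total endowment satisfies $\Lambda>0$, and that the initial allocation $(\alpha^m_0)_{m=1,\dots,M}$ of $\Lambda$ satisfies $\alpha^m_0\neq 0$ for $m=1,\dots,M$. Then an Arrow-Debreu equilibrium exists if and only if there is an allocation $(\alpha^m)_{m=1,\dots,M}$ of $\Lambda$ such that $$\mathbb{E}\big[|U_m(\alpha^m)| + U'_m(\alpha^m)\Lambda\big] < \infty, \quad m=1,\dots,M.$$
   Context: Let $M\in\{1,2,\dots\}$ (number of agents) and let $(\mathbf{S},\mathcal{S},\mu)$ be a measure space with $\sigma$-finite measure $\mu$. $\mathbf{L}^0$ is the space of ($\mu$-equivalence classes of) measurable functions on $\mathbf{S}$ with values in $[-\infty,\infty)$, and $\mathbf{L}^0_+$ is the cone of non-negative elements of $\mathbf{L}^0$. (In)equalities between measurable functions are understood $\mu$-a.e.; $\alpha\neq 0$ means that $\alpha$ is not the zero element of $\mathbf{L}^0$. For $\alpha\in\mathbf{L}^0$ write $\mathbb{E}[\alpha]=\int_{\mathbf{S}}\alpha(s)\,\mu(ds)$, with the convention $\mathbb{E}[\alpha]=-\infty$ whenever $\mathbb{E}[\min(\alpha,0)]=-\infty$. For each $m=1,\dots,M$, $U_m:[0,\infty)\to\mathbf{L}^0$ is a measurable field (for each $c$, $s\mapsto U_m(c)(s)$ is measurable). For $\alpha\in\mathbf{L}^0_+$, $U_m(\alpha)$ denotes $s\mapsto U_m(\alpha(s))(s)$, and similarly for $U_m'(\alpha)$,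 where $U'_m$ is the derivative in $c$. Assumption on utilities: for every $m$ and every $s\in\mathbf{S}$ the function $c\mapsto U_m(c)(s)$ on $(0,\infty)$ is strictly increasing, strictly concave, continuously differentiable, and satisfies the Inada conditions $\lim_{c\to\infty}U_m'(c)(s)=0$ and $\lim_{c\downarrow 0}U_m'(c)(s)=\infty$. At $c=0$, by continuity, $U_m(0)(s)=\lim_{c\downarrow 0}U_m(c)(s)$, which may be $-\infty$. We set $U_m'(0)=\infty$. $\Lambda\in\mathbf{L}^0_+$ is the total endowment. An allocation of $\Lambda$ is a family $(\alpha^m)_{m=1,\dots,M}$ of elements of $\mathbf{L}^0_+$ with $\sum_{m=1}^M\alpha^m=\Lambda$. The initial allocation $(\alpha_0^m)_{m=1,\dots,M}$ is a given allocation of $\Lambda$. An Arrow-Debreu equilibrium is a pair $(\zeta,(\alpha_1^m)_{m=1,\dots,M})$ consisting of a measurable function $\zeta>0$ (state price density) and an allocation $(\alpha^m_1)$ of $\Lambda$ (equilibrium allocation) such that $\mathbb{E}[\zeta\Lambda]<\infty$ and, for each $m=1,\dots,M$, $\mathbb{E}[|U_m(\alpha^m_1)|]<\infty$ and $\alpha_1^m$ is the maximizer of $\mathbb{E}[U_m(\alpha)]$ over all $\alpha\in\mathbf{L}^0_+$ with $\mathbb{E}[\zeta(\alpha-\alpha^m_0)]=0$. *)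

(* Defs.v *)
From HB Require Import structures.
From mathcomp Require Import all_boot all_order all_algebra.
From mathcomp Require Import all_classical all_reals all_analysis.
From mathcomp Require Import measurable_realfun.

Set Implicit Arguments.
Unset Strict Implicit.
Unset Printing Implicit Defensive.
Import Order.TTheory GRing.Theory Num.Theory.
Import numFieldNormedType.Exports.
Local Open Scope classical_set_scope.
Local Open Scope ring_scope.

Definition strictly_concave_on (R : realType) (A : set R) (f : R -> R) : Prop :=
  forall x y t : R, A x -> A y -> x != y -> 0 < t < 1 ->
    t * f x + (1 - t) * f y < f (t * x + (1 - t) * y).

(* Conditions on the function [c |-> u c] at a fixed state.  Only the values on
   [0, +oo) matter; they are finite on (0, +oo), while [u 0] may be -oo. *)
Record utility_function (R : realType) (u : R -> \bar R) : Prop := {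
  utility_fin_num : forall c : R, 0 < c -> u c \is a fin_num ;
  utility_increasing : forall x y : R, 0 < x -> x < y -> (u x < u y)%E ;
  utility_concave : strictly_concave_on `]0, +oo[ (fine \o u) ;
  utility_derivable : forall c : R, 0 < c -> derivable (fine \o u) c 1 ;
  utility_deriv_continuous :
    forall c : R, 0 < c -> {for c, continuous (fine \o u)^`()%classic} ;
  utility_Inada_oo : (fine \o u)^`()%classic c @[c --> +oo%R] --> 0 ;
  utility_Inada_0 : (fine \o u)^`()%classic c @[c --> 0^'+] --> +oo%R ;
  utility_at0 : u c @[c --> 0^'+] --> u 0 }.

Definition marginal (R : realType) (u : R -> \bar R) (c : R) : \bar R :=
  if c == 0 then +oo%E else ((fine \o u)^`()%classic c)%:E.

Section economy.
Context d (S : measurableType d) (R : realType).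
Variable mu : {measure set S -> \bar R}.
Implicit Types (f : S -> \bar R) (U : R -> S -> \bar R).

(* [U c s] is the utility of consuming [c] in state [s]. *)
Definition utility_field U : Prop :=
  (forall c : R, 0 <= c -> measurable_fun setT (U c)) /\
  (forall s, utility_function (U^~ s)).

(* Classes in L^0 are handled through representatives.  Every non-negative class
   has a representative that is non-negative everywhere, which is what makes
   [U (a s) s] meaningful for all [s]. *)
Definition L0plus (a : S -> R) : Prop :=
  measurable_fun setT a /\ forall s, 0 <= a s.

(* As [+oo - oo = -oo] in [\bar R], the library integral follows the convention
   that the mean is -oo as soon as that of the negative part is; see
   [mean_convention] below. *)
Definition mean f : \bar R := \int[mu]_s f s.

Lemma mean_convention f :
  mean (fun s => mine (f s) 0)%E = -oo%E -> mean f = -oo%E.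
Proof.
have negE : (fun s => mine (f s) 0)^\-%E = f^\-%E.
  apply/funext => s; rewrite !funenegE oppe_min oppe0.
  by apply/max_idPl; rewrite le_max lexx orbT.
have posE : (fun s => mine (f s) 0)^\+%E = cst 0%E.
  by apply/funext => s; rewrite funeposE; apply/max_idPr; rewrite ge_min lexx orbT.
rewrite /mean [in X in X -> _]integralE [in X in _ -> X]integralE.
rewrite posE negE integral0 add0e => ->.
by rewrite addeNy.
Qed.

Variables (M : nat) (U : 'I_M -> R -> S -> \bar R).

Definition allocation (Lambda : S -> R) (a : 'I_M -> S -> R) : Prop :=
  (forall m, L0plus (a m)) /\
  {ae mu, forall s, \sum_(m < M) a m s = Lambda s}.

Definition budget (zeta a0 : S -> R) : set (S -> R) :=
  [set a | L0plus a /\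
           mean (fun s => (zeta s * (a s - a0 s))%:E) = 0%E].

(* The maximizer, unique as an element of L^0. *)
Definition is_the_maximizer (B : set (S -> R)) (V : R -> S -> \bar R)
    (a1 : S -> R) : Prop :=
  B a1 /\
  forall a, B a ->
    (mean (fun s => V (a s) s) <= mean (fun s => V (a1 s) s))%E /\
    (mean (fun s => V (a s) s) = mean (fun s => V (a1 s) s) ->
     {ae mu, forall s, a s = a1 s}).

Record arrow_debreu_equilibrium (Lambda : S -> R) (a0 : 'I_M -> S -> R)
    (zeta : S -> R) (a1 : 'I_M -> S -> R) : Prop := {
  ade_measurable : measurable_fun setT zeta ;
  ade_positive : {ae mu, forall s, 0 < zeta s} ;
  ade_allocation : allocation Lambda a1 ;
  ade_finite_price :
    (mean (fun s => (zeta s * Lambda s)%:E) < +oo)%E ;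
  ade_finite_utility : forall m,
    (mean (fun s => `|U m (a1 m s) s|) < +oo)%E ;
  ade_optimal : forall m,
    is_the_maximizer (budget zeta (a0 m)) (U m) (a1 m) }.

End economy.

(* Main.v *)
Require Import Defs.
From mathcomp Require Import all_boot all_order all_algebra.
From mathcomp Require Import all_classical all_reals all_analysis.
From mathcomp Require Import measurable_realfun.
From mathcomp Require Import lra zify.
Import Order.TTheory GRing.Theory Num.Theory.
Import numFieldNormedType.Exports.
Local Open Scope classical_set_scope.
Local Open Scope ring_scope.
Set Implicit Arguments.
Unset Strict Implicit.
Unset Printing Implicit Defensive.

(** Necessity: in equilibrium an agent consumes somewhere, so on a set of
    positive measure his marginal utility, even at half of his consumption, is
    below [r] times the price for some [r].  Selling there and buying where the
    marginal utility exceeds [r + 1] times the price would be profitable; hence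
    his marginal utility is at most [(r + 1) zeta] almost everywhere, and
    [zeta Lambda] is integrable.

    Sufficiency (Negishi): for weights [w] in the simplex, let [zeta w] be the
    price and [pi w] the allocation with [w m * U'_m (pi w m) = zeta w] and
    [\sum_m pi w m = Lambda].  In each state some agent consumes at least
    [alpha m], so [zeta w <= \sum_m U'_m (alpha m)], whatever [w] is.  By
    dominated convergence the values [E [zeta w * (pi w m - alpha0 m)]] are
    continuous in [w]; they sum to zero and are non-positive when [w m = 0].
    Such a field on the simplex has a zero, which follows from Scarf's
    combinatorial lemma, and the weights of a zero are positive since
    [alpha0 m] is not zero.  The tangent inequality for [U_m] then shows that
    [pi w m] is optimal. *)

(** * Scarf's lemma and a zero of an inward field on the simplex *)

Section Scarf.
Local Open Scope nat_scope.
Local Open Scope set_scope.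
Variables (I Y : finType) (r : I -> Y -> nat).
Hypothesis r_inj : forall i, injective (r i).

(** These are Scarf's primitive sets: no point lies strictly above the minimum of [t] in every order
    at once. *)
Definition dominant (t : {set Y}) : bool :=
  [forall y, [exists i, [forall (x | x \in t), (r i y <= r i x)%N]]].

Lemma dominantP (t : {set Y}) :
  reflect (forall y, exists i, forall x, x \in t -> (r i y <= r i x)%N)
          (dominant t).
Proof.
apply: (iffP forallP) => h y.
- by have /existsP[i /forall_inP ?] := h y; exists i.
- by have [i ?] := h y; apply/existsP; exists i; apply/forall_inP.
Qed.

(** [above] and [top_above] single out the elements that can complete [t] to a dominant cell as its
    new minimum in the order [j]. *)
Definition above (t : {set Y}) (j : I) (y : Y) : Prop :=
  forall i, i != j -> exists2 x, x \in t & (r i x < r i y)%N.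

Definition top_above (t : {set Y}) (j : I) (y : Y) : Prop :=
  above t j y /\ forall z, above t j z -> (r j z <= r j y)%N.

Lemma top_above_exists t j y : above t j y -> exists z, top_above t j z.
Proof.
move=> ty.
have [z /asboolP tz zmax] :=
  @arg_maxnP Y y (fun z => `[< above t j z >]) (r j) (introT (asboolP _) ty).
by exists z; split => // w tw; apply: zmax; apply/asboolP.
Qed.

Lemma top_above_unique t j y z : top_above t j y -> top_above t j z -> y = z.
Proof.
move=> [ty ymax] [tz zmax]; apply: (r_inj (i := j)).
by apply/eqP; rewrite eqn_leq ymax // zmax.
Qed.

(** A point [z] that is above [t] in all orders but [j] is blocked by [t] in the order [j], and by
    [y] as well since [y] is the highest such point. Any other [z] is blocked by [t] in some order
    [i != j], where [y] does not lower the minimum. *)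
Lemma top_above_dominant (t : {set Y}) j y :
  dominant t -> top_above t j y -> dominant (y |: t).
Proof.
move=> /dominantP dt [ty ymax]; apply/dominantP => z.
have [tz|ntz] := pselect (above t j z).
- have [i hi] := dt z; have ij : i = j.
    apply/eqP/negP => /negP ij; have [x xt xz] := tz _ ij.
    by have := hi _ xt; rewrite leqNgt xz.
  exists j => x /setU1P[->|xt]; first exact: ymax.
  by rewrite -ij hi.
- move/existsNP: ntz => [i /not_implyP[ij hi]].
  have {}hi : forall x, x \in t -> (r i z <= r i x)%N.
    move=> x xt; rewrite leqNgt; apply/negP => xz.
    by apply: hi; exists x.
  exists i => x /setU1P[->|]; last exact: hi.
  have [x' x't x'y] := ty _ ij.
  exact: leq_trans (hi _ x't) (ltnW x'y).
Qed.

(** Dominance assigns to each element of the cell an order in which it is minimal. This map is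
    injective, hence bijective by cardinality, so every order has its own minimal element; [j] is
    the order of [y]. *)
Lemma dominant_top_above (t : {set Y}) y :
  #|t|.+1 = #|I| -> y \notin t -> dominant (y |: t) ->
  exists2 j, top_above t j y &
    forall i, i != j -> exists2 x, x \in t &
      (forall x', x' \in t -> (r i x <= r i x')%N) /\
      (forall k, (forall x', x' \in t -> (r k x <= r k x')%N) -> k != j -> k = i).
Proof.
move=> ct yt /dominantP dom.
have [f fP] := choice dom.
have finj : {in y |: t &, injective f}.
  move=> x x' xt x't fxx'; apply: (r_inj (i := f x)); apply/eqP.
  by rewrite eqn_leq fP //= fxx' fP.
have fsurj i : i \in f @: (y |: t).
  suff -> : f @: (y |: t) = [set: I] by rewrite inE.
  apply/eqP; rewrite eqEcard finset.subsetT /= cardsT -ct card_in_imset //.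
  by rewrite cardsU1 yt.
have fneq i : i != f y -> exists2 x, x \in t & i = f x.
  move=> iy; have /imsetP[x /setU1P[xy|xt] ifx] := fsurj i; last by exists x.
  by rewrite ifx xy eqxx in iy.
exists (f y).
- split => [i /fneq[x xt ->]|z tz].
  + exists x => //; rewrite ltn_neqAle fP ?setU11 // andbT.
    by apply: contra yt => /eqP/r_inj <-.
  + have [i hi] := dom z.
    have [<-|ne] := eqVneq i (f y); first by apply: hi; rewrite setU11.
    have [x xt xz] := tz _ ne.
    by have := hi x; rewrite setU1r // leqNgt xz => /(_ isT).
- move=> i /fneq[x xt ->]; exists x => //; split => [x' x't|k kmin /fneq[x' x't kx']].
  + by apply: fP; rewrite setU1r.
  + rewrite kx'; congr f; apply: (r_inj (i := k)); apply/eqP.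
    by rewrite eqn_leq kmin // andbT kx' fP ?setU1r.
Qed.

(** There is one order more than elements of [t], so two orders [i1] and [i2] share their minimum in
    [t]. A completion becomes the minimum in one order and leaves distinct minima to the others, so
    that order is [i1] or [i2]; each of the two yields exactly one completion. *)
Lemma card_dominant_completions (t : {set Y}) x0 :
  x0 \in t -> #|t|.+1 = #|I| -> (forall j, exists y, above t j y) ->
  dominant t ->
  #|[set y | (y \notin t) && dominant (y |: t)]%SET| = 2.
Proof.
move=> x0t ct ht dt.
have /choice[a aP] i : exists x, x \in t /\
    forall x', x' \in t -> (r i x <= r i x')%N.
  by have [x xt xmin] := @arg_minnP Y x0 (mem t) (r i) x0t; exists x.
have [i1 [i2 i12 a12]] : exists i1, exists2 i2, i1 != i2 & a i1 = a i2.
  apply/injectivePn; apply/injectiveP => ainj.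
  have : (#|a @: [set: I]| <= #|t|)%N.
    by apply/subset_leq_card/fintype.subsetP => _ /imsetP[i _ ->]; apply: (aP i).1.
  by rewrite card_imset // cardsT -ct ltnn.
have minimizer_above i y : y \in t -> (forall k, k != i -> exists2 x, x \in t &
    (r k x < r k y)%N) -> forall x, x \in t -> (r i y <= r i x)%N.
  move=> yt ty; have [k hk] := dominantP _ dt y.
  suff <- : k = i by [].
  apply/eqP/negP => /negP/ty[x xt]; rewrite ltnNge => /negP; apply.
  exact: hk.
have argminE i y : y \in t -> (forall x, x \in t -> (r i y <= r i x)%N) -> y = a i.
  move=> yt ymin; apply: (r_inj (i := i)); apply/eqP.
  by rewrite eqn_leq ymin ?(aP i).2 // (aP i).1.
(* Inside [t], such a [y] would be minimal in the order [i], hence also in the order [k], in which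
   it lies strictly above some element of [t]. *)
have notin i k y : i != k -> a i = a k -> above t i y -> y \notin t.
  move=> ik aik ty; apply/negP => yt.
  have yE := argminE i y yt (minimizer_above i y yt ty).
  have [|x xt] := ty k; first by rewrite eq_sym.
  by rewrite ltnNge yE aik (aP k).2.
have [y1 y1P] := let: ex_intro _ h := ht i1 in top_above_exists h.
have [y2 y2P] := let: ex_intro _ h := ht i2 in top_above_exists h.
have y12 : y1 != y2.
  apply/eqP => y12; have [i hi] := dominantP _ dt y1.
  have [x xt] : exists2 x, x \in t & (r i x < r i y1)%N.
    have [ii1|/y1P.1//] := eqVneq i i1.
    by rewrite y12; apply: y2P.1; rewrite ii1.
  by rewrite ltnNge hi.
suff -> : [set y | (y \notin t) && dominant (y |: t)]%SET = [set y1; y2]%SET.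
  by rewrite cards2 y12.
apply/setP => y; rewrite !inE; apply/andP/orP => [[yt dyt]|].
- have [j yj jP] := dominant_top_above ct yt dyt.
  have [j1|j1] := eqVneq j i1.
    by left; apply/eqP/(@top_above_unique t j); rewrite // j1.
  have [j2|j2] := eqVneq j i2.
    by right; apply/eqP/(@top_above_unique t j); rewrite // j2.
  have [|x xt [xmin /(_ i2)]] := jP i1; first by rewrite eq_sym.
  rewrite (argminE i1 x xt xmin) a12 eq_sym => /(_ (aP i2).2 j2) i21.
  by rewrite i21 eqxx in i12.
- case=> /eqP->; split.
  + exact: notin i12 a12 y1P.1.
  + exact: top_above_dominant dt y1P.
  + by apply: (@notin i2 i1 y2 _ _ y2P.1) => //; rewrite eq_sym.
  + exact: top_above_dominant dt y2P.
Qed.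

Variable e : I -> Y.
Hypothesis e_inj : injective e.
Hypothesis e_min : forall i y, (r i (e i) <= r i y)%N.
Hypothesis e_max :
  forall i j y, i != j -> y \notin codom e -> (r i y < r i (e j))%N.
Variable c : Y -> I.
Hypothesis ce : cancel e c.

(** In an order [i != i0] the facet contains the lowest element [e i], so a point outside the facet
    can only be blocked in the order [i0]. The one completion is therefore the highest element
    outside the facet in that order. *)
Lemma card_outer_completions i0 :
  #|[set y | (y \notin [set e i | i in [set~ i0]]) &&
      dominant (y |: [set e i | i in [set~ i0]])]%SET| = 1.
Proof.
set t := [set e i | i in [set~ i0]]%SET.
have et i : (e i \in t) = (i != i0).
  apply/imsetP/idP => [[k]|ii0]; last by exists i; rewrite // !inE.
  by rewrite !inE => ki /e_inj ->.
have [y yt ymax] : exists2 y, y \notin t &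
    forall z, z \notin t -> (r i0 z <= r i0 y)%N.
  have e0 : e i0 \notin t by rewrite et eqxx.
  by have [y yt ymax] := @arg_maxnP Y (e i0) [pred y | y \notin t] (r i0) e0; exists y.
apply/eqP/cards1P; exists y; apply/setP => z; rewrite !inE.
apply/andP/eqP => [[zt /dominantP dz]|->{z}].
- apply: (r_inj (i := i0)); apply/eqP; rewrite eqn_leq ymax //=.
  have [i hi] := dz y.
  have [<-|ii0] := eqVneq i i0; first by rewrite hi ?setU11.
  have yE : y = e i.
    apply: (r_inj (i := i)); apply/eqP.
    by rewrite eqn_leq e_min andbT hi // inE et ii0 orbT.
  by rewrite yE et ii0 in yt.
- split=> //; apply/dominantP => z.
  have [/imsetP[i _ ->]|zt] := boolP (z \in t); first by exists i.
  exists i0 => x /setU1P[->|]; first exact: ymax.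
  move=> /imsetP[i]; rewrite !inE => ii0 ->.
  have [/codomP[j zj]|zn] := boolP (z \in codom e).
    by move: zt; rewrite zj et negbK => /eqP->; apply: e_min.
  by apply/ltnW/e_max; rewrite // eq_sym.
Qed.

(** A facet with these colours other than the outer one contains a non-slack element, so that every
    [e j] is above it in all orders but [j]. It then has two completions if it is dominant, and none
    otherwise, because subsets of dominant sets are dominant. *)
Lemma odd_completions i0 (t : {set Y}) :
  #|t|.+1 = #|I| -> c @: t = [set~ i0]%SET ->
  odd #|[set y | (y \notin t) && dominant (y |: t)]%SET| =
  (t == [set e i | i in [set~ i0]]%SET).
Proof.
move=> ct ctE.
have [->|tne] := eqVneq t; first by rewrite card_outer_completions.
have [x xt xe] : exists2 x, x \in t & x \notin codom e.
  apply/exists_inP; apply: contraR tne => /exists_inPn te.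
  have {}te x : x \in t -> exists i, x = e i.
    by move=> /te; rewrite negbK => /codomP.
  apply/eqP/setP => x; apply/idP/imsetP => [xt|[i ii0 ->]].
    have [i xi] := te _ xt; exists i => //.
    by rewrite -ctE; apply/imsetP; exists x => //; rewrite xi ce.
  move: ii0; rewrite -ctE => /imsetP[y yt ->].
  by have [k yk] := te _ yt; rewrite yk ce -yk.
have [dt|ndt] := boolP (dominant t).
  rewrite (@card_dominant_completions t x) // => j; exists (e j) => i ij.
  by exists x => //; apply: e_max.
rewrite (_ : [set y | _]%SET = finset.set0) ?cards0 //.
apply/setP => y; rewrite !inE; apply/negP => /andP[_ /dominantP dy].
move/negP: ndt; apply; apply/dominantP => z; have [i hi] := dy z.
by exists i => w wt; apply: hi; rewrite inE wt orbT.
Qed.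

(** If [t] bears all colours, only the removal of the element coloured [i0] qualifies. Otherwise a
    qualifying facet exists only if exactly one colour is repeated, and either of the two elements
    bearing it may be removed. *)
Lemma odd_facets i0 (t : {set Y}) :
  #|t| = #|I| ->
  odd #|[set x in t | c @: (t :\ x) == [set~ i0]]%SET| =
  (c @: t == [set: I])%SET.
Proof.
move=> ct.
have cardD x : x \in t -> #|t :\ x|.+1 = #|I| by move=> xt; rewrite -ct (cardsD1 x t) xt.
have [ctE|ctE] := eqVneq.
- have cinj : {in t &, injective c}.
    by apply/imset_injP; rewrite ctE cardsT ct.
  have /imsetP[x xt xi0] : i0 \in c @: t by rewrite ctE inE.
  rewrite (_ : [set x in t | _]%SET = [set x]%SET) ?cards1 //.
  apply/setP => y; rewrite !inE; apply/andP/eqP => [[yt /eqP cy]|->{y}].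
    apply/eqP; apply: contraT => yx.
    have : i0 \in c @: (t :\ y).
      by apply/imsetP; exists x => //; rewrite !inE eq_sym yx.
    by rewrite cy !inE eqxx.
  split=> //; apply/eqP/setP => i; rewrite !inE.
  apply/imsetP/idP => [[y]|ii0].
    rewrite !inE => /andP[yx yt] ->; apply: contra yx => /eqP yi0.
    by apply/eqP/cinj; rewrite // yi0.
  have /imsetP[y yt yi] : i \in c @: t by rewrite ctE inE.
  exists y => //; rewrite !inE yt andbT; apply: contra ii0 => /eqP yx.
  by rewrite yi yx -xi0.
- have [->|[x]] := set_0Vmem [set x in t | c @: (t :\ x) == [set~ i0]]%SET.
    by rewrite cards0.
  rewrite !inE => /andP[xt /eqP cx].
  have cinj : {in t :\ x &, injective c}.
    apply/imset_injP; rewrite cx cardsC1.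
    by apply/eqP; rewrite -(cardD x xt).
  have cxi0 : c x != i0.
    apply: contra ctE => /eqP cxi0; apply/eqP/setP => i; rewrite inE.
    have [->|ii0] := eqVneq i i0; first by rewrite -cxi0; apply/imsetP; exists x.
    have /imsetP[y] : i \in c @: (t :\ x) by rewrite cx !inE.
    by rewrite !inE => /andP[_ yt] ->; apply/imsetP; exists y.
  have /imsetP[x'] : c x \in c @: (t :\ x) by rewrite cx !inE.
  rewrite !inE => /andP[x'x x't] cxx'.
  rewrite (_ : [set x in t | _]%SET = [set x; x']%SET) ?cards2 1?eq_sym ?x'x //.
  apply/setP => y; rewrite !inE; apply/andP/orP => [[yt /eqP cy]|].
    have [->|yx] := eqVneq y x; [by left|right].
    have /imsetP[z] : c y \in c @: (t :\ y).
      by rewrite cy -cx; apply/imsetP; exists y; rewrite // !inE yx.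
    rewrite !inE => /andP[zy zt] cyz.
    have zx : z = x.
      apply/eqP; apply: contraT => zx; move: zy.
      by rewrite (cinj y z) ?eqxx // !inE ?yx ?zx.
    apply/eqP/cinj; rewrite ?inE ?yx ?x'x ?x't ?yt //.
    by rewrite cyz zx.
  case=> /eqP->; split; rewrite ?cx //.
  rewrite -cx; apply/eqP/setP => i.
  apply/imsetP/imsetP => -[z]; rewrite !inE => /andP[zx zt] ->.
    have [->|zx0] := eqVneq z x; first by exists x'; rewrite // !inE x'x.
    by exists z; rewrite // !inE zx0.
  have [->|zx'] := eqVneq z x'; first by exists x; rewrite // !inE eq_sym x'x.
  by exists z; rewrite // !inE zx'.
Qed.

(* Parity: the pairs of a dominant cell and a facet of it bearing all the
   colours but [i0] are counted along the cells and along the facets. *)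
Lemma rainbow_cell (i0 : I) :
  exists t : {set Y}, [/\ #|t| = #|I|, dominant t & c @: t = [set: I]%SET].
Proof.
pose D := [pred f : {set Y} | (#|f|.+1 == #|I|) && (c @: f == [set~ i0]%SET)].
pose C := [pred t : {set Y} | (#|t| == #|I|) && dominant t].
have count : (\sum_(t | C t) #|[set x in t | c @: (t :\ x) == [set~ i0]]| =
    \sum_(f | D f) #|[set y | (y \notin f) && dominant (y |: f)]|)%N%SET.
  transitivity (\sum_(t | C t) \sum_(f | D f) (f \subset t))%N%SET.
    apply: eq_bigr => t /andP[/eqP ct dt].
    rewrite -big_mkcondr /= sum1_card -(@card_in_imset _ _ (fun x => t :\ x)).
      apply: eq_card => f; rewrite [RHS]unfold_in.
      apply/imsetP/andP => [[x]|[/andP[/eqP cf cfE] ft]].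
        rewrite !inE => /andP[xt cx] ->; split; last exact: finset.subD1set.
        by rewrite cx andbT -ct (cardsD1 x t) xt.
      have /cards1P[x fx] : #|t :\: f| == 1%N.
        by rewrite cardsD (finset.setIidPr ft) ct -cf subSnn.
      have xtf : x \in t :\: f by rewrite fx inE.
      exists x; last first.
        by rewrite -fx finset.setDDr finset.setDv finset.set0U; apply/esym/finset.setIidPr.
      move: xtf; rewrite !inE => /andP[xf ->] /=.
      by rewrite -fx finset.setDDr finset.setDv finset.set0U (finset.setIidPr ft).
    move=> x y; rewrite !inE => /andP[xt _] /andP[yt _] txy.
    apply/eqP; apply: contraT => xy.
    have : x \in t :\ y by rewrite !inE xy.
    by rewrite -txy !inE eqxx.
  rewrite exchange_big /=; apply: eq_bigr => f /andP[/eqP cf cfE].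
  rewrite -big_mkcondr /= sum1_card -(@card_in_imset _ _ (fun x => x |: f)).
    apply: eq_card => t; rewrite [RHS]unfold_in.
    apply/andP/imsetP => [[/andP[/eqP ct dt] ft]|[x]].
      have /cards1P[x fx] : #|t :\: f| == 1%N.
        by rewrite cardsD (finset.setIidPr ft) ct -cf subSnn.
      have tE : t = x |: f.
        by rewrite -fx finset.setUC -{1}(finset.setID t f) (finset.setIidPr ft).
      exists x => //; have : x \in t :\: f by rewrite fx inE.
      by rewrite !inE => /andP[-> _]; rewrite -tE.
    rewrite !inE => /andP[xf dx] ->; split; last exact: finset.subsetUr.
    by rewrite dx andbT cardsU1 xf -cf.
  move=> x y; rewrite !inE => /andP[xf _] /andP[yf _] fxy.
  have : x \in y |: f by rewrite -fxy setU11.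
  by rewrite !inE (negPf xf) orbF => /eqP.
have [t /and3P[/eqP ct dt /eqP cE]] :
    exists t : {set Y}, [&& #|t| == #|I|, dominant t & c @: t == [set: I]%SET].
  apply/existsP; apply: contraT => /existsPn none.
  (* Without a cell of all colours the count is even along the cells, but it is odd along the facets
     because of the outer one. *)
  have even_cells : 2 %| \sum_(t | C t) #|[set x in t | c @: (t :\ x) == [set~ i0]]%SET|.
    apply: dvdn_sum => t /andP[/eqP ct dt]; rewrite dvdn2 odd_facets //.
    by move: (none t); rewrite ct eqxx dt.
  have outer : D [set e i | i in [set~ i0]]%SET.
    rewrite /= card_imset // cardsC1 prednK ?eqxx /=; last by apply/card_gt0P; exists i0.
    apply/eqP/setP => i; apply/imsetP/idP => [[_ /imsetP[k ki0 ->] ->]|ii0].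
      by rewrite ce.
    by exists (e i); rewrite ?ce //; apply/imsetP; exists i.
  move: even_cells; rewrite count (bigD1 _ outer) /= dvdn_addl.
    by rewrite card_outer_completions.
  apply: dvdn_sum => f /andP[/andP[/eqP cf /eqP cfE] fne].
  by rewrite dvdn2 (odd_completions cf cfE) fne.
by exists t.
Qed.
End Scarf.

(* Scarf's lemma: [I] is added to the points as slack elements, [i] being the
   lowest one for the order [i] and above all points for the other orders. *)
Lemma scarf (I T : finType) (r : I -> T -> nat) (c : T -> I) :
  (0 < #|I|)%N -> (forall i, injective (r i)) ->
  exists t : {set T}, forall y, exists2 i, i \in [set c x | x in t]%SET &
    forall x, x \in t -> (r i y <= r i x)%N.
Proof.
move=> /card_gt0P[i0 _] r_inj.
pose B := (\sum_i \sum_x r i x)%N.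
have rB i x : (r i x <= B)%N.
  by rewrite /B (bigD1 i) //= (bigD1 x) //= -addnA leq_addr.
(* The successor reserves the rank 0 for the slack element of the order [i]; points have rank at
   most [B + 1], and [enum_rank k] separates the remaining slack elements above them. *)
pose r' i (y : (T + I)%type) : nat := match y with
  | inl x => (r i x).+1
  | inr k => if k == i then 0%N else (B + (enum_rank k).+2)%N end.
have r'_inj i : injective (r' i).
  move=> [x|k] [y|l] /=.
  - by case=> /r_inj ->.
  - by have := rB i x; case: ifP => // _; lia.
  - by have := rB i y; case: ifP => // _; lia.
  - have [->|_] := eqVneq k i; have [->|_] := eqVneq l i => //; try lia.
    by move=> h; congr inr; apply/enum_rank_inj/val_inj => /=; lia.
pose c' (y : (T + I)%type) := match y with inl x => c x | inr k => k end.
have [t [_ /dominantP dt tE]] : exists t : {set (T + I)%type},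
    [/\ #|t| = #|I|, dominant r' t & c' @: t = [set: I]%SET]%SET.
  apply: (@rainbow_cell _ _ r' r'_inj inr) => //.
  - by move=> ? ? [].
  - by move=> i [x|k] /=; rewrite eqxx.
  - move=> i j [x|k] ij; last by rewrite codom_f.
    by move=> _ /=; rewrite eq_sym (negPf ij); have := rB i x; lia.
exists [set x | inl x \in t]%SET => y.
have [i hi] := dt (inl y); exists i; last by move=> x; rewrite inE => /hi.
(* The colour [i] is borne by a point of [T]: its slack element has rank 0 in the order [i], so [y]
   could not be below it. *)
have /imsetP[[x|k] xt ik] : i \in (c' @: t)%SET by rewrite tE inE.
- by apply/imsetP; exists x; rewrite ?inE.
- by have := hi _ xt; rewrite /= ik eqxx.
Qed.
(** Scarf's lemma, with the coordinates as orders on the grid points of sum [N], yields a set [t]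
    whose colours form [C]. The minima over [t] of the coordinates in [C] add up to more than
    [N - M]; hence the points of [t] differ by less than [M] in each coordinate, and their
    coordinates outside [C] are below [M]. *)
Lemma grid_labelling (M N : nat) (c : ('I_M -> nat) -> 'I_M) : (0 < M)%N ->
  exists (x : 'I_M -> nat) (y : 'I_M -> 'I_M -> nat),
    [/\ (\sum_j x j = N)%N, forall i, (\sum_j y i j = N)%N,
        forall i j, (y i j < x j + M)%N /\ (x j < y i j + M)%N &
        forall i, c (y i) = i \/ (x i < M)%N].
Proof.
move=> M_gt0.
pose T := {g : {ffun 'I_M -> 'I_N.+1} | (\sum_i g i == N)%N}.
have sumT (x : T) : (\sum_i val x i = N)%N by apply/eqP; exact: valP x.
have mkT (g : 'I_M -> nat) : (\sum_i g i = N)%N ->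
    exists x : T, forall i, val x i = g i :> nat.
  move=> gN; have gi i : (g i < N.+1)%N by rewrite ltnS -gN (bigD1 i) //= leq_addr.
  have fN : (\sum_i [ffun i => Ordinal (gi i)] i == N)%N.
    by rewrite -[X in _ == X]gN; apply/eqP/eq_bigr => i _; rewrite ffunE.
  exists (exist (fun g : {ffun 'I_M -> 'I_N.+1} => (\sum_i g i)%N == N) _ fN) => i.
  by rewrite /= ffunE.
(* The rank only breaks the ties between the points with equal [i]-th coordinate. *)
pose r i (x : T) := (val x i * #|{: T}| + enum_rank x)%N.
have r_le i x y : (r i y <= r i x)%N -> (val y i <= val x i)%N.
  apply: contraTT; rewrite -!ltnNge => xy; apply: (@leq_trans ((val x i).+1 * #|{: T}|)).
    by rewrite /r mulSn addnC ltn_add2r ltn_ord.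
  by apply: leq_trans (leq_addr _ _); rewrite leq_mul2r xy orbT.
have r_inj i : injective (r i).
  move=> x y xy; apply/enum_rank_inj/val_inj/eqP => /=.
  have : val x i = val y i :> nat.
    by apply/eqP; rewrite eqn_leq !r_le ?xy.
  by move=> e; move/eqP: xy; rewrite /r e eqn_add2l.
have I_gt0 : (0 < #|'I_M|)%N by rewrite card_ord.
have [t tP] := @scarf _ T r (fun x => c (fun i => val x i)) I_gt0 r_inj.
set C := [set c (fun i => val x i : nat) | x : T in t]%SET in tP.
have big_simplex (g : 'I_M -> nat) : (\sum_(i in C) (g i).+1 <= N)%N ->
    (exists i, i \in C) -> exists x : T, forall i, i \in C -> (g i < val x i)%N.
  move=> gN [k kC].
  (* What is left of [N] is put on the single coordinate [k], and nothing outside [C]. *)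
  pose h i := if i \in C then
      ((g i).+1 + (if i == k then N - \sum_(i in C) (g i).+1 else 0))%N
    else 0%N.
  have [|x xh] := mkT h.
    rewrite /h -big_mkcond /= big_split /= -big_mkcondr /=.
    rewrite (_ : \sum_(i in C | i == k) _ = N - \sum_(i in C) (g i).+1)%N ?subnKC //.
    rewrite (big_pred1 k) // => i.
    by rewrite /=; have [->|_] := eqVneq i k; rewrite ?kC ?andbF.
  by exists x => i iC; rewrite xh /h iC leq_addr.
have [k0 k0C] : exists i, i \in C.
  have [|x0 _] := mkT (fun i => if i == Ordinal M_gt0 then N else 0%N).
    by rewrite -big_mkcond big_pred1_eq.
  by have [i iC _] := tP x0; exists i.
have [x0 x0t] : exists x, x \in t by case/imsetP: k0C => x; exists x.
have /choice[a aP] i : exists a, (exists2 x, x \in t & val x i = a :> nat) /\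
    forall x, x \in t -> (a <= val x i)%N.
  have [x xt xmin] := @arg_minnP T x0 (mem t) (fun x => val x i) x0t.
  by exists (val x i); split; [exists x|].
(* Otherwise raising the minima on [C] gives a grid point that violates the
   dominance of [t]. *)
have aN : (N < \sum_(i in C) (a i).+1)%N.
  rewrite ltnNge; apply/negP => /big_simplex[|x xa]; first by exists k0.
  have [i iC xi] := tP x; have [[z zt za] _] := aP i.
  by have := xa _ iC; rewrite -za ltnNge (r_le _ _ _ (xi _ zt)).
have cardC : (#|C| <= M)%N by rewrite -[M in leqRHS]card_ord max_card.
have aN' : (N < \sum_(i in C) a i + M)%N.
  apply: leq_trans aN _; under eq_bigr => i _ do rewrite -addn1.
  by rewrite big_split /= sum1_card leq_add2l.
have out x i : x \in t -> i \notin C -> (val x i < M)%N.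
  move=> xt iC; have := sumT x; rewrite (bigID (mem C)) /=.
  rewrite [X in (_ + X)%N](bigD1 i) //=.
  have : (\sum_(j in C) a j <= \sum_(j in C) val x j)%N.
    by apply: leq_sum => j _; apply: (aP j).2.
  by move: aN' => /=; lia.
have inn x i : x \in t -> i \in C -> (val x i < a i + M)%N.
  move=> xt iC; have := sumT x; rewrite (bigID (mem C)) /= (bigD1 i) //=.
  have : (\sum_(j in C | j != i) a j <= \sum_(j in C | j != i) val x j)%N.
    by apply: leq_sum => j _; apply: (aP j).2.
  by move: aN'; rewrite (bigD1 i) //= => /=; lia.
have near x y j : x \in t -> y \in t -> (val x j < val y j + M)%N.
  move=> xt yt; have [jC|jC] := boolP (j \in C).
    by apply: leq_trans (inn _ _ xt jC) _; rewrite leq_add2r (aP j).2.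
  by apply: leq_trans (out _ _ xt jC) _; rewrite leq_addl.
have /choice[y yP] i : exists y : T, y \in t /\ (i \in C -> c (fun i => val y i) = i).
  have [/imsetP[y yt iE]|iC] := boolP (i \in C); last by exists x0.
  by exists y; split=> // _; rewrite -iE.
exists (fun i => val x0 i : nat), (fun i j => val (y i) j : nat); split=> //.
- by move=> i j; have [yt _] := yP i; split; apply: near.
- move=> i; have [iC|iC] := boolP (i \in C); first by left; apply: (yP i).2.
  by right; apply: out.
Qed.

Lemma increasing_seq_cvg_infty (f : nat -> nat) :
  increasing_seq f -> f n @[n --> \oo] --> \oo.
Proof.
move=> /increasing_seqP f_incr.
have f_ge n : (n <= f n)%N by elim: n => // n ih; apply: leq_ltn_trans ih (f_incr n).
by apply/cvgnyPge => A; exists A => // n /= An; apply: leq_trans An (f_ge n).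
Qed.

Lemma bolzano_weierstrass_fin (R : realType) (I : finType) (x : nat -> I -> R) :
  (forall n i, `|x n i| <= 1) ->
  exists (f : nat -> nat) (l : I -> R), f n @[n --> \oo] --> \oo /\
    forall i, x (f n) i @[n --> \oo] --> l i.
Proof.
move=> x_le1.
suff [f f_incr fs] : exists2 f : nat -> nat, increasing_seq f &
    forall i, i \in enum I -> cvgn (fun n => x (f n) i).
  exists f, (fun i => limn (fun n => x (f n) i)).
  by split=> [|i]; [apply: increasing_seq_cvg_infty|apply: fs; rewrite mem_enum].
elim: (enum I) => [|i s [f f_incr fs]]; first by exists id.
have [|g g_incr gi] := @bolzano_weierstrass R (fun n => x (f n) i).
  exists 1; split; first exact: num_real.
  by move=> y y1 n _ /=; apply: le_trans (x_le1 _ _) (ltW y1).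
exists (f \o g) => [m n /=|j]; first by rewrite f_incr -leEnat g_incr.
rewrite inE => /predU1P[->//|js].
have /cvg_ex[l jl] := fs _ js; apply/cvg_ex; exists l.
exact: (cvg_comp _ _ (increasing_seq_cvg_infty g_incr) jl).
Qed.

Lemma cvg_sumr (R : realType) (I : finType) (T : Type) (F : set_system T)
    (FF : Filter F) (x : T -> I -> R) (l : I -> R) :
  (forall i, x n i @[n --> F] --> l i) ->
  \sum_i x n i @[n --> F] --> \sum_i l i.
Proof.
move=> xl; elim: (index_enum I) => [|i s ih].
  rewrite big_nil (_ : (fun n => _) = cst 0); first exact: cvg_cst.
  by apply/funext => n; rewrite big_nil.
rewrite big_cons (_ : (fun n => _) = (fun n => x n i + \sum_(j <- s) x n j)).
  exact: cvgD.
by apply/funext => n; rewrite big_cons.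
Qed.

Definition simplex (R : realType) (I : finType) (w : I -> R) : Prop :=
  (forall i, 0 <= w i) /\ \sum_i w i = 1.

Lemma simplex_le1 (R : realType) (I : finType) (w : I -> R) i :
  simplex w -> w i <= 1.
Proof.
by move=> [w0 w1]; rewrite -w1 (bigD1 i) //= lerDl sumr_ge0.
Qed.

Lemma simplex_gt0 (R : realType) (I : finType) (w : I -> R) :
  simplex w -> exists i, 0 < w i.
Proof.
move=> [w0 w1]; apply/not_existsP => w_le0.
move: w1; rewrite big1 => [/eqP|i _]; first by rewrite eq_sym oner_eq0.
by apply/eqP; rewrite eq_le w0 andbT leNgt; apply/negP/w_le0.
Qed.

(** A grid point is coloured by an index at which [f] is non-positive, which exists since the values
    sum to zero. The points found on finer and finer grids accumulate at some [w]. If [w i > 0],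
    points of colour [i] converge to [w], so [f w i <= 0]; if [w i = 0], the face condition says so.
    Non-positive values with sum zero vanish. *)
Lemma simplex_zero (R : realType) (M : nat)
    (f : ('I_M -> R) -> 'I_M -> R) : (0 < M)%N ->
  (forall (w_ : nat -> 'I_M -> R) w, (forall n, simplex (w_ n)) -> simplex w ->
     (forall i, w_ n i @[n --> \oo] --> w i) ->
     forall i, f (w_ n) i @[n --> \oo] --> f w i) ->
  (forall w, simplex w -> \sum_i f w i = 0) ->
  (forall w i, simplex w -> w i = 0 -> f w i <= 0) ->
  exists2 w, simplex w & forall i, f w i = 0.
Proof.
move=> M_gt0 f_cont f_sum f_face.
pose p N (x : 'I_M -> nat) i : R := (x i)%:R / N.+1%:R.
have p_simplex N (x : 'I_M -> nat) : (\sum_i x i = N.+1)%N -> simplex (p N x).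
  move=> xN; split=> [i|]; first by rewrite divr_ge0.
  by rewrite -mulr_suml -natr_sum xN divff.
have near N : exists (x : 'I_M -> R) (y : 'I_M -> 'I_M -> R),
    [/\ simplex x, forall i, simplex (y i),
        forall i j, `|x j - y i j| <= M%:R / N.+1%:R &
        forall i, f (y i) i <= 0 \/ x i <= M%:R / N.+1%:R].
  have /choice[c cP] (x : 'I_M -> nat) : exists m, (\sum_i x i = N.+1)%N -> f (p N x) m <= 0.
    have [xN|] := pselect (\sum_i x i = N.+1)%N; last by exists (Ordinal M_gt0).
    apply/not_existsP => f_gt0.
    have {}f_gt0 m : 0 < f (p N x) m.
      by rewrite ltNge; apply/negP => fm; apply: (f_gt0 m).
    have := f_sum _ (p_simplex _ _ xN); apply/eqP; rewrite gt_eqF //.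
    by rewrite (bigD1 (Ordinal M_gt0)) //= ltr_pwDl // sumr_ge0 // => i _; apply/ltW.
  have [x [y [xN yN xy cx]]] := grid_labelling N.+1 c M_gt0.
  exists (p N x), (fun i => p N (y i)); split.
  - exact: p_simplex.
  - by move=> i; apply: p_simplex.
  - move=> i j; have [/ltnW yx /ltnW xy'] := xy i j.
    rewrite /p -mulrBl normrM normfV (ger0_norm (ler0n _ _)) ler_pM2r ?invr_gt0 ?ltr0n //.
    have {yx} : (y i j)%:R <= (x j)%:R + M%:R :> R by rewrite -natrD ler_nat.
    have {xy'} : (x j)%:R <= (y i j)%:R + M%:R :> R by rewrite -natrD ler_nat.
    by move=> h1 h2; rewrite ler_norml; apply/andP; split; lra.
  - move=> i; case: (cx i) => [ci|xi]; [left|right].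
      by rewrite -[X in f _ X]ci; apply: cP.
    by rewrite ler_pM2r ?invr_gt0 ?ltr0n // ler_nat ltnW.
have /choice[x /choice[y xyP]] := near.
have [|g [w [g_oo xw]]] := @bolzano_weierstrass_fin R _ x.
  move=> n i; have [sx _ _ _] := xyP n.
  by rewrite ger0_norm ?simplex_le1 //; apply: sx.1.
have e0 : M%:R / (g n).+1%:R @[n --> \oo] --> (0 : R).
  rewrite -[X in _ --> X](mulr0 M%:R); apply: cvgM; first exact: cvg_cst.
  exact: (cvg_comp _ _ g_oo (@cvg_harmonic R)).
have yw i j : y (g n) i j @[n --> \oo] --> w j.
  have -> : (fun n => y (g n) i j) = (fun n => x (g n) j - (x (g n) j - y (g n) i j)).
    by apply/funext => n; rewrite opprB addrC subrK.
  rewrite -[X in _ --> X]subr0; apply: cvgB; first exact: xw.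
  apply: norm_cvg0.
  apply: (squeeze_cvgr _ (cvg_cst 0) e0); apply: nearW => n.
  by rewrite normr_ge0 /=; have [_ _ /(_ i j)] := xyP (g n).
have w_simplex : simplex w.
  split=> [i|].
    apply: (ler_cvg_to (cvg_cst 0) (xw i)); apply: nearW => n.
    by have [[x0 _] _ _ _] := xyP (g n); apply: x0.
  have sum_cvg : \sum_i x (g n) i @[n --> \oo] --> \sum_i w i.
    exact: cvg_sumr.
  suff sum1 : \sum_i x (g n) i @[n --> \oo] --> (1 : R).
    exact: (cvg_unique _ sum_cvg sum1).
  rewrite (_ : (fun n => _) = cst 1); first exact: cvg_cst.
  by apply/funext => n; have [[]] := xyP (g n).
have f_le0 i : f w i <= 0.
  rewrite leNgt; apply/negP => fi_gt0.
  have wi_gt0 : 0 < w i.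
    rewrite lt_neqAle w_simplex.1 andbT eq_sym; apply: contraTneq fi_gt0 => wi0.
    by rewrite -leNgt f_face.
  have near_gt : \forall n \near \oo, 0 < x (g n) i - M%:R / (g n).+1%:R.
    by apply: (cvgr_gt (w i)) => //; rewrite -[X in _ --> X]subr0; apply: cvgB.
  have fy : f (y (g n) i) i @[n --> \oo] --> f w i.
    by apply: f_cont => // n; have [_ sy _ _] := xyP (g n).
  have : f w i <= 0.
    apply: (ler_cvg_to fy (cvg_cst 0)); apply: filterS near_gt => n; rewrite subr_gt0 => xn.
    have [_ _ _ /(_ i)[//|]] := xyP (g n).
    by rewrite leNgt xn.
  by rewrite leNgt fi_gt0.
exists w => // i; apply/eqP; rewrite eq_le f_le0 /=.
have := f_sum _ w_simplex; rewrite (bigD1 i) //= => /eqP; rewrite addr_eq0 => /eqP ->.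
by rewrite oppr_ge0 sumr_le0.
Qed.

(** * Utility functions, demand and prices in a single state *)

Section Tangent.
Variables (R : realType) (v : R -> R).
Hypothesis v_concave : strictly_concave_on `]0, +oo[ v.

Lemma concave_tangent_le p x : 0 < p -> 0 < x -> derivable v p 1 ->
  v x <= v p + derive1 v p * (x - p).
Proof.
move=> p0 x0 dv; have [->|xp] := eqVneq x p; first by rewrite subrr mulr0 addr0.
have diff_v : differentiable v p by apply/derivable1_diffP.
have slope : t^-1 *: (v (t *: (x - p) + p) - v p) @[t --> 0^'+] --> derive1 v p * (x - p).
  have -> : derive1 v p * (x - p) = 'D_(x - p) v p.
    by rewrite deriveE // deriv1E // mulrC.
  by apply: cvg_dnbhs_at_right; apply: diff_derivable.
rewrite -lerBlDl; apply: (ler_cvg_to (cvg_cst (v x - v p)) slope).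
near=> t; have t0 : 0 < t by near: t; apply: nbhs_right_gt.
have t1 : t < 1 by near: t; apply: nbhs_right_lt.
rewrite ler_pdivlMl //; have := v_concave _ _ xp _.
move=> /(_ t); rewrite /= !in_itv /= !andbT => /(_ x0 p0); rewrite t0 t1 => /(_ isT).
rewrite (_ : t * x + (1 - t) * p = t *: (x - p) + p); last first.
  by rewrite /GRing.scale /= mulrBr mulrBl mul1r; lra.
lra.
Unshelve. all: by end_near. Qed.

(** At the midpoint of [p] and [x] the function is strictly above the chord and not above the
    tangent. *)
Lemma strictly_concave_tangent p x : 0 < p -> 0 < x -> x != p -> derivable v p 1 ->
  v x < v p + derive1 v p * (x - p).
Proof.
move=> p0 x0 xp dv; pose h : R := 2^-1.
have h01 : 0 < h < 1 by rewrite /h; lra.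
have mid := v_concave _ _ xp h01; rewrite /= !in_itv /= !andbT in mid.
have {mid} := mid x0 p0.
have m0 : 0 < h * x + (1 - h) * p by rewrite addr_gt0 // mulr_gt0 //; lra.
have := concave_tangent_le p0 m0 dv.
set g := derive1 v p; set y := v _.
have -> : h * x + (1 - h) * p - p = h * (x - p) by lra.
rewrite mulrCA; set e := g * _; rewrite /h; lra.
Qed.

End Tangent.

Section Utility.
Variables (R : realType) (u : R -> \bar R).
Hypothesis u_utility : utility_function u.
Let g := derive1 (fine \o u).

Lemma utility_EFin c : 0 < c -> u c = (fine (u c))%:E.
Proof. by move=> c0; rewrite fineK //; apply: utility_fin_num. Qed.

Lemma marginalE c : 0 < c -> marginal u c = (g c)%:E.
Proof. by move=> c0; rewrite /marginal gt_eqF. Qed.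

Lemma derivative_gt0 c : 0 < c -> 0 < g c.
Proof.
move=> c0; have c1 : 0 < c + 1 by rewrite addr_gt0.
have := concave_tangent_le (utility_concave u_utility) c0 c1 (utility_derivable u_utility c0).
have : (u c < u (c + 1))%E by apply: utility_increasing => //; rewrite ltrDl.
rewrite (utility_EFin c0) (utility_EFin c1) lte_fin /= -/g; lra.
Qed.

Lemma derivative_decreasing x y : 0 < x -> x < y -> g y < g x.
Proof.
move=> x0 xy; have y0 : 0 < y by apply: lt_trans xy.
have := strictly_concave_tangent (utility_concave u_utility) x0 y0 _
  (utility_derivable u_utility x0).
have := strictly_concave_tangent (utility_concave u_utility) y0 x0 _
  (utility_derivable u_utility y0).
rewrite (lt_eqF xy) (gt_eqF xy) -/g => /(_ isT) h1 /(_ isT) h2.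
have : 0 < (y - x) * (g x - g y) by rewrite mulrBr; lra.
by rewrite pmulr_rgt0 subr_gt0.
Qed.

Lemma utility_right_continuous x : 0 <= x -> u y @[y --> x^'+] --> u x.
Proof.
rewrite le_eqVlt => /predU1P[<-|x0]; first exact: utility_at0.
rewrite (utility_EFin x0); apply: cvg_EFin.
  near=> y; apply: utility_fin_num => //.
  by apply: lt_trans x0 _; near: y; apply: nbhs_right_gt.
apply: cvg_at_right_filter; apply: differentiable_continuous.
by apply/derivable1_diffP; apply: utility_derivable.
Unshelve. all: by end_near. Qed.

Lemma marginal_right_continuous x : 0 <= x ->
  marginal u y @[y --> x^'+] --> marginal u x.
Proof.
move=> x0.
suff gx : (g y)%:E @[y --> x^'+] --> marginal u x.
  apply: cvg_trans gx; apply: near_eq_cvg; near=> y.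
  rewrite marginalE //; apply: le_lt_trans x0 _.
  by near: y; apply: nbhs_right_gt.
move: x0; rewrite le_eqVlt => /predU1P[<-|x0].
  rewrite /marginal eqxx; apply/cvgeryP; exact: (utility_Inada_0 u_utility).
rewrite marginalE //; apply: cvg_EFin; first exact: nearW.
by apply: cvg_at_right_filter; apply: (utility_deriv_continuous u_utility).
Unshelve. all: by end_near. Qed.

Lemma utility_le x y : 0 <= x -> x <= y -> (u x <= u y)%E.
Proof.
move=> x0; rewrite le_eqVlt => /predU1P[->//|xy].
apply: (lee_cvg_to (utility_right_continuous x0) (cvg_cst (u y))).
near=> c.
have xc : x < c by near: c; apply: nbhs_right_gt.
have cy : c < y by near: c; apply: nbhs_right_lt.
exact/ltW/(utility_increasing u_utility (le_lt_trans x0 xc) cy).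
Unshelve. all: by end_near. Qed.

Lemma marginal_le x y : 0 <= x -> x <= y -> (marginal u y <= marginal u x)%E.
Proof.
move=> x0; rewrite le_eqVlt => /predU1P[->//|xy].
have y0 : 0 < y by apply: le_lt_trans xy.
move: x0; rewrite le_eqVlt => /predU1P[<-|x0]; first by rewrite /marginal eqxx leey.
by rewrite !marginalE // lee_fin ltW // derivative_decreasing.
Qed.

Lemma marginal_gt0 x : 0 <= x -> (0 < marginal u x)%E.
Proof.
rewrite le_eqVlt => /predU1P[<-|x0]; first by rewrite /marginal eqxx.
by rewrite marginalE // lte_fin derivative_gt0.
Qed.

(** The new case is [x = 0], where [u] may be [-oo]. The tangent at [h = p / 2] bounds [u 0], and it
    passes at 0 below the tangent at [p] because its slope is larger. *)
Lemma utility_tangent p x : 0 < p -> 0 <= x -> x != p ->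
  (u x < (fine (u p) + g p * (x - p))%:E)%E.
Proof.
move=> p0; rewrite le_eqVlt => /predU1P[<- _|x0 xp]; last first.
  rewrite (utility_EFin x0) lte_fin.
  by have := strictly_concave_tangent (utility_concave u_utility) p0 x0 xp
    (utility_derivable u_utility p0).
pose h := p / 2; have h0 : 0 < h by rewrite divr_gt0.
have hp : h < p by rewrite /h; lra.
have hu : fine (u h) < fine (u p) + g p * (h - p).
  have hneqp : h != p by rewrite lt_eqF.
  by have := strictly_concave_tangent (utility_concave u_utility) p0 h0 hneqp
    (utility_derivable u_utility p0).
have gh := derivative_decreasing h0 hp.
suff u0 : (u 0 <= (fine (u h) - g h * h)%:E)%E.
  apply: le_lt_trans u0 _; rewrite lte_fin sub0r.
  have : 0 < h * (g h - g p) by rewrite mulr_gt0 // subr_gt0.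
  have -> : g p * - p = - (g p * h) + g p * (h - p) by lra.
  lra.
(* At [e / g h] the tangent at [h] has risen by exactly [e] from its value at 0. *)
apply/lee_addgt0Pr => e e0; have c0 : 0 < e / g h by rewrite divr_gt0 // derivative_gt0.
apply: le_trans (utility_le (lexx 0) (ltW c0)) _.
rewrite (utility_EFin c0) -EFinD lee_fin.
have := concave_tangent_le (utility_concave u_utility) h0 c0 (utility_derivable u_utility h0).
rewrite mulrBr -/g [g h * (e / g h)]mulrC divfK ?gt_eqF ?derivative_gt0 //=; lra.
Qed.

Lemma derivative_surjective z : 0 < z -> exists2 x, 0 < x & g x = z.
Proof.
move=> z0.
have [a /= [a0 ga]] : exists a, 0 < a /\ z < g a.
  have /cvgryPgt/(_ z) ga := utility_Inada_0 u_utility.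
  near (0 : R)^'+ => a; exists a; split.
    by near: a; apply: nbhs_right_gt.
  by near: a.
have [b [ab gb]] : exists b, a < b /\ g b < z.
  have gb : \forall c \near +oo%R, g c < z.
    exact: (cvgr_lt (0 : R) (utility_Inada_oo u_utility)).
  near (pinfty_nbhs R) => b; exists b; split; near: b => //.
  by apply: nbhs_pinfty_gt; rewrite num_real.
have cont : {within `[a, b], continuous g}.
  apply: continuous_in_subspaceT => c; rewrite inE /= in_itv /= => /andP[ac _].
  by apply: (utility_deriv_continuous u_utility); apply: lt_le_trans ac.
have [|c] := @IVT R g a b z (ltW ab) cont.
  by rewrite ge_min le_max (ltW ga) (ltW gb) orbT.
by rewrite in_itv /= => /andP[ac _] <-; exists c => //; apply: lt_le_trans ac.
Unshelve. all: by end_near. Qed.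

End Utility.

(** For a strictly decreasing positive function, surjectivity onto the positive numbers expresses
    continuity and both Inada limits at once. *)
Definition inada (R : realType) (g : R -> R) : Prop :=
  [/\ forall c, 0 < c -> 0 < g c,
      forall x y, 0 < x -> x < y -> g y < g x &
      forall z, 0 < z -> exists2 x, 0 < x & g x = z].

Lemma utility_inada (R : realType) (u : R -> \bar R) :
  utility_function u -> inada (derive1 (fine \o u)).
Proof.
move=> hu; split.
- exact: derivative_gt0.
- exact: derivative_decreasing.
- exact: derivative_surjective.
Qed.

(* The consumption equating the weighted marginal utility with the price [z];
   it is [0] for the weight [w = 0]. *)
Definition demand (R : realType) (g : R -> R) (w z : R) : R :=
  xget 0 [set x | 0 < x /\ w * g x = z].

Section Demand.
Variables (R : realType) (g : R -> R).
Hypothesis g_inada : inada g.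

Lemma demand0 z : 0 < z -> demand g 0 z = 0.
Proof.
move=> z0; apply: xgetPN => x [_]; rewrite mul0r => z_eq.
by rewrite -z_eq ltxx in z0.
Qed.

Lemma demandP w z : 0 < w -> 0 < z -> 0 < demand g w z /\ w * g (demand g w z) = z.
Proof.
move=> w0 z0; have [_ _ g_surj] := g_inada.
apply: (@xgetPex _ 0 [set x | 0 < x /\ w * g x = z]).
have [x x0 gx] := g_surj (z / w) (divr_gt0 z0 w0).
by exists x; split=> //; rewrite gx mulrC divfK // gt_eqF.
Qed.

Lemma demand_ge0 w z : 0 <= w -> 0 < z -> 0 <= demand g w z.
Proof.
rewrite le_eqVlt => /predU1P[<-|w0] z0; first by rewrite demand0.
by have [/ltW] := demandP w0 z0.
Qed.

(** The right-hand side is linear in [w] and [z], and it makes sense for [w = 0]. Continuity and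
    measurability of the demand are read off from this comparison and its mirror image
    [demand_lt]. *)
Lemma lt_demand w z q : 0 <= w -> 0 < z -> 0 < q ->
  (q < demand g w z) = (z < w * g q).
Proof.
rewrite le_eqVlt => /predU1P[<-|w0] z0 q0.
  by rewrite demand0 // mul0r ltNge (ltW q0) ltNge (ltW z0).
have [x0 xz] := demandP w0 z0; have [_ g_decr _] := g_inada.
rewrite -[in RHS]xz ltr_pM2l //.
case: (ltgtP q) => [qx|xq|->]; last by rewrite ltxx.
- by rewrite g_decr.
- by apply/esym/negbTE; rewrite -leNgt ltW // g_decr.
Qed.

Lemma demand_lt w z q : 0 <= w -> 0 < z -> 0 < q ->
  (demand g w z < q) = (w * g q < z).
Proof.
rewrite le_eqVlt => /predU1P[<-|w0] z0 q0; first by rewrite demand0 // mul0r z0 q0.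
have [x0 xz] := demandP w0 z0; have [_ g_decr _] := g_inada.
rewrite -[in RHS]xz ltr_pM2l //.
case: (ltgtP q) => [qx|xq|->]; last by rewrite ltxx.
- by apply/esym/negbTE; rewrite -leNgt ltW // g_decr.
- by rewrite g_decr.
Qed.

Lemma demand_decreasing w z z' : 0 < w -> 0 < z -> z < z' ->
  demand g w z' < demand g w z.
Proof.
move=> w0 z0 zz'; have [x0 xz] := demandP w0 z0.
by rewrite demand_lt ?xz // ?ltW // (lt_trans z0).
Qed.

Lemma cvg_demand (T : Type) (F : set_system T) (FF : Filter F) (w z : T -> R) (w0 z0 : R) :
  0 <= w0 -> 0 < z0 -> (\forall t \near F, 0 <= w t) ->
  w t @[t --> F] --> w0 -> z t @[t --> F] --> z0 ->
  demand g (w t) (z t) @[t --> F] --> demand g w0 z0.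
Proof.
move=> w0_ge0 z0_gt0 w_ge0 wF zF.
have z_gt0 : \forall t \near F, 0 < z t by apply: (cvgr_gt z0).
apply/cvgrPdist_lt => e e0; pose x := demand g w0 z0.
have x0 : 0 <= x by apply: demand_ge0.
have hi : \forall t \near F, demand g (w t) (z t) < x + e.
  have xe0 : 0 < x + e by apply: ltr_wpDl.
  have : 0 < z0 - w0 * g (x + e) by rewrite subr_gt0 -demand_lt // ltrDl.
  have : z t - w t * g (x + e) @[t --> F] --> z0 - w0 * g (x + e).
    by apply: cvgB => //; apply: cvgMl.
  move=> /cvgr_gt h /h; apply: filterS3 w_ge0 z_gt0 => t wt zt.
  by rewrite subr_gt0 -demand_lt.
have lo : \forall t \near F, x - e < demand g (w t) (z t).
  (* A point strictly between [x - e] and [x] that is also positive, as [lt_demand] requires. *)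
  pose q := Num.max ((x - e / 2)) (x / 2).
  have [xe|ex] := ltP (x - e) 0.
    apply: filterS2 w_ge0 z_gt0 => t wt zt; apply: lt_le_trans xe _.
    exact: demand_ge0.
  have x_gt0 : 0 < x by lra.
  have q0 : 0 < q by rewrite lt_max; apply/orP; right; lra.
  have qx : q < x by rewrite gt_max; apply/andP; split; lra.
  have xq : x - e < q by rewrite lt_max; apply/orP; left; lra.
  have : 0 < w0 * g q - z0 by rewrite subr_gt0 -lt_demand.
  have : w t * g q - z t @[t --> F] --> w0 * g q - z0.
    by apply: cvgB => //; apply: cvgMl.
  move=> /cvgr_gt h /h; apply: filterS3 w_ge0 z_gt0 => t wt zt.
  by rewrite subr_gt0 -lt_demand // => /(lt_trans xq).
apply: filterS2 lo hi => t lo hi; rewrite -/x ltr_norml; lra.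
Qed.

End Demand.

Section Price.
Variables (R : realType) (M : nat) (g : 'I_M -> R -> R).
Hypothesis g_inada : forall i, inada (g i).

Definition total_demand (w : 'I_M -> R) (z : R) : R :=
  \sum_i demand (g i) (w i) z.

Definition price (w : 'I_M -> R) (L : R) : R :=
  xget 1 [set z | 0 < z /\ total_demand w z = L].

Lemma total_demand_decreasing w z z' : simplex w -> 0 < z -> z < z' ->
  total_demand w z' < total_demand w z.
Proof.
move=> sw z0 zz'; have [i wi] := simplex_gt0 sw.
rewrite /total_demand [ltLHS](bigD1 i) // [ltRHS](bigD1 i) //=.
apply: ltr_leD; first exact: demand_decreasing.
apply: ler_sum => j _; have := sw.1 j; rewrite le_eqVlt => /predU1P[<-|wj].
  by rewrite !demand0 // (lt_trans z0).
exact/ltW/demand_decreasing.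
Qed.

Lemma priceP w L : simplex w -> 0 < L ->
  0 < price w L /\ total_demand w (price w L) = L.
Proof.
move=> sw L0; have [w_ge0 _] := sw; have [i0 wi0] := simplex_gt0 sw.
have M0 : 0 < M%:R :> R by rewrite ltr0n (leq_ltn_trans _ (ltn_ord i0)).
have g_gt0 i c : 0 < c -> 0 < g i c by have [h _ _] := g_inada i; apply: h.
(* At this price agent [i0] alone demands [L]. *)
pose a := w i0 * g i0 L.
have a0 : 0 < a by rewrite mulr_gt0 // g_gt0.
have La : L <= total_demand w a.
  rewrite /total_demand (bigD1 i0) //=.
  have : L <= demand (g i0) (w i0) a by rewrite leNgt demand_lt // ltxx.
  move=> /le_trans; apply; rewrite lerDl sumr_ge0 // => i _.
  exact: demand_ge0.
(* At this price each of the [M] agents demands at most [L / M%:R]; the summand [a] ensures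
   [a <= b]. *)
pose b := a + \sum_i w i * g i (L / M%:R).
have LM : 0 < L / M%:R by rewrite divr_gt0.
have ab : a <= b by rewrite lerDl sumr_ge0 // => i _; rewrite mulr_ge0 // ltW // g_gt0.
have b0 : 0 < b by apply: lt_le_trans ab.
have bL : total_demand w b <= L.
  have -> : L = \sum_(i < M) L / M%:R.
    by rewrite sumr_const card_ord -(mulr_natr (L / M%:R)) divfK // gt_eqF.
  apply: ler_sum => i _; rewrite leNgt lt_demand // -leNgt.
  rewrite /b (bigD1 i) //= addrCA lerDl; apply: addr_ge0; first exact: ltW.
  by apply: sumr_ge0 => j _; rewrite mulr_ge0 // ltW // g_gt0.
have cont : {within `[a, b], continuous (total_demand w)}.
  apply: continuous_in_subspaceT => z; rewrite inE /= in_itv /= => /andP[az _].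
  have z0 : 0 < z by apply: lt_le_trans az.
  apply: cvg_sumr => i; apply: cvg_demand => //; [exact: nearW|exact: cvg_cst].
have [|z] := @IVT R (total_demand w) a b L ab cont.
  by rewrite ge_min le_max bL La orbT.
rewrite in_itv /= => /andP[az _] zL; apply: (@xgetPex _ 1 [set z | 0 < z /\ total_demand w z = L]).
by exists z; split=> //; apply: lt_le_trans az.
Qed.

Lemma lt_price w L z : simplex w -> 0 < L -> 0 < z ->
  (z < price w L) = (L < total_demand w z).
Proof.
move=> sw L0 z0; have [p0 pL] := priceP sw L0; rewrite -[in RHS]pL.
case: (ltgtP z) => [zp|pz|->]; last by rewrite ltxx.
- by rewrite total_demand_decreasing.
- by apply/esym/negbTE; rewrite -leNgt ltW // total_demand_decreasing.
Qed.

Lemma price_lt w L z : simplex w -> 0 < L -> 0 < z ->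
  (price w L < z) = (total_demand w z < L).
Proof.
move=> sw L0 z0; have [p0 pL] := priceP sw L0; rewrite -[in RHS]pL.
case: (ltgtP z) => [zp|pz|->]; last by rewrite ltxx.
- by apply/esym/negbTE; rewrite -leNgt ltW // total_demand_decreasing.
- by rewrite total_demand_decreasing.
Qed.

Lemma cvg_price (w_ : nat -> 'I_M -> R) (w : 'I_M -> R) L :
  (forall n, simplex (w_ n)) -> simplex w -> 0 < L ->
  (forall i, w_ n i @[n --> \oo] --> w i) ->
  price (w_ n) L @[n --> \oo] --> price w L.
Proof.
move=> sw_ sw L0 w_w; have [p0 _] := priceP sw L0.
have total_cvg z : 0 < z -> total_demand (w_ n) z @[n --> \oo] --> total_demand w z.
  move=> z0; apply: cvg_sumr => i; apply: cvg_demand => //.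
  - exact: sw.1.
  - by apply: nearW => n; apply: (sw_ n).1.
  - exact: cvg_cst.
apply/cvgrPdist_lt => e e0.
have pe0 : 0 < price w L + e by rewrite addr_gt0.
have hi : \forall n \near \oo, price (w_ n) L < price w L + e.
  have : total_demand w (price w L + e) < L by rewrite -price_lt // ltrDl.
  move=> /(cvgr_lt _ (total_cvg _ pe0)); apply: filterS => n.
  by rewrite -price_lt.
have lo : \forall n \near \oo, price w L - e < price (w_ n) L.
  have [pe|] := leP (price w L - e) 0.
    apply: nearW => n; apply: le_lt_trans pe _.
    by have [] := priceP (sw_ n) L0.
  move=> pe; have : L < total_demand w (price w L - e).
    by rewrite -lt_price // ltrBlDr ltrDl.
  move=> /(cvgr_gt _ (total_cvg _ pe)); apply: filterS => n.
  by rewrite -lt_price.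
apply: filterS2 lo hi => n lo hi; rewrite ltr_norml; lra.
Qed.

Lemma price_le (w a : 'I_M -> R) L : simplex w -> 0 < L ->
  (forall i, 0 < a i) -> \sum_i a i = L -> price w L <= \sum_i g i (a i).
Proof.
move=> sw L0 a0 aL; have [p0 pL] := priceP sw L0.
have g_gt0 i c : 0 < c -> 0 < g i c by have [h _ _] := g_inada i; apply: h.
have [i ai] : exists i, a i <= demand (g i) (w i) (price w L).
  apply/not_existsP => lt_a; have [i0 _] := simplex_gt0 sw.
  have lt_a' i : demand (g i) (w i) (price w L) < a i by rewrite ltNge; apply/negP/lt_a.
  have : total_demand w (price w L) < \sum_i a i.
    rewrite /total_demand [ltLHS](bigD1 i0) // [ltRHS](bigD1 i0) //=.
    by apply: ltr_leD => //; apply: ler_sum => i _; apply/ltW.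
  by rewrite pL aL ltxx.
have wp : price w L <= w i * g i (a i).
  by rewrite leNgt -demand_lt -?leNgt //; apply: sw.1.
apply: (le_trans wp); rewrite (bigD1 i) //=; apply: ler_wpDr.
  by apply: sumr_ge0 => j _; apply/ltW/g_gt0.
by rewrite ler_piMl ?simplex_le1 // ltW // g_gt0.
Qed.

End Price.

(** * Measurability in the state *)

Section Measurability.
Context d (S : measurableType d) (R : realType).

Lemma measurable_set_lt (f g : S -> R) : measurable_fun setT f ->
  measurable_fun setT g -> measurable [set s | f s < g s].
Proof.
move=> mf mg; rewrite -[X in measurable X]setTI.
rewrite (_ : [set s | f s < g s] = [set s | ((f s)%:E < (g s)%:E)%E]).
  by apply: measurable_lte => //; apply/measurable_EFinP.
by apply/seteqP; split=> s /=; rewrite lte_fin.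
Qed.

Lemma measurable_fun_lt (f : S -> R) :
  (forall r, measurable [set s | f s < r]) -> measurable_fun setT f.
Proof.
move=> mf mT; apply: (measurability _ (RGenInftyO.measurableE R)) => //.
by move=> _ [_ [r ->] <-]; rewrite setTI preimage_itvNyo; apply: mf.
Qed.

Lemma emeasurable_fun_lt (f : S -> \bar R) :
  (forall r : R, measurable [set s | (f s < r%:E)%E]) -> measurable_fun setT f.
Proof.
move=> mf mT; apply: (measurability _ (ErealGenInftyO.measurableE R)) => //.
by move=> _ [_ [r ->] <-]; rewrite setTI preimage_itvNyo; apply: mf.
Qed.

(** By monotonicity and right-continuity, [F (a s) s < r] holds exactly when some rational [q > a s]
    satisfies [F q s < r], so the sublevel set is a countable union of measurable sets. *)
Lemma measurable_fun_eval (F : R -> S -> \bar R) (a : S -> R) :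
  measurable_fun setT a -> (forall s, 0 <= a s) ->
  (forall q, 0 < q -> measurable_fun setT (F q)) ->
  (forall s x y, 0 <= x -> x <= y -> (F x s <= F y s)%E) ->
  (forall s x, 0 <= x -> F y s @[y --> x^'+] --> F x s) ->
  measurable_fun setT (fun s => F (a s) s).
Proof.
move=> ma a0 mF F_nd F_rc; apply: emeasurable_fun_lt => r.
rewrite [X in measurable X](_ : _ = \bigcup_(q in [set q : rat | 0 < q])
    ([set s | a s < ratr q] `&` [set s | (F (ratr q) s < r%:E)%E])); last first.
  apply/seteqP; split=> s /= => [Fr|[q q0 [aq Fq]]]; last first.
    by apply: le_lt_trans Fq; apply: F_nd => //; apply: ltW.
  have F_near : \forall y \near (a s)^'+, (F y s < r%:E)%E.
    by apply: (F_rc s (a s) (a0 s) [set x | (x < r%:E)%E]); apply: open_ereal_lt'.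
  near (a s)^'+ => y.
  have ay : a s < y by near: y; apply: nbhs_right_gt.
  have Fy : (F y s < r%:E)%E by near: y.
  have [q] := rat_in_itvoo ay; rewrite in_itv /= => /andP[aq qy].
  have q0 : 0 < ratr q :> R by apply: le_lt_trans aq.
  exists q; first by rewrite /= -(ltr0q R).
  by split=> //; apply: le_lt_trans Fy; apply: F_nd; apply: ltW.
rewrite bigcup_mkcond; apply: bigcupT_measurable_rat => q.
case: ifPn => [|_]; last exact: measurable0.
rewrite inE /= => q0; have {}q0 : 0 < ratr q :> R by rewrite ltr0q.
apply: measurableI; first by apply: measurable_set_lt.
rewrite -[X in measurable X]setTI.
apply: measurable_lte => //; exact: mF.
Unshelve. all: by end_near. Qed.

Section Fields.
Variable U : R -> S -> \bar R.
Hypothesis U_field : utility_field U.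

Lemma measurable_utility (a : S -> R) : L0plus a ->
  measurable_fun setT (fun s => U (a s) s).
Proof.
move=> [ma a0]; have [mU hU] := U_field; apply: measurable_fun_eval => //.
- by move=> q q0; apply: mU; apply: ltW.
- by move=> s x y; apply: (utility_le (hU s)).
- by move=> s x x0; apply: (utility_right_continuous (hU s)).
Qed.

Lemma measurable_derivative q : 0 < q ->
  measurable_fun setT (fun s => derive1 (fine \o U^~ s) q).
Proof.
move=> q0; have [mU hU] := U_field.
pose h n s := n.+1%:R * (fine (U (n.+1%:R^-1 + q) s) - fine (U q s)).
apply: (@measurable_fun_cvg _ _ _ _ h) => [n|s _].
  apply: measurable_funM => //; apply: measurable_funB.
    by apply: measurableT_comp => //; apply: mU; rewrite addr_ge0 // ltW.
  by apply: measurableT_comp => //; apply: mU; rewrite ltW.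
rewrite derive1E; have /cvgr_dnbhsP := utility_derivable (hU s) q0.
move=> /(_ (@harmonic R)) /= slope.
have {}slope := slope (conj (fun n => lt0r_neq0 (harmonic_gt0 n)) cvg_harmonic).
apply: cvg_trans slope; apply: near_eq_cvg; apply: nearW => n.
by rewrite /h invrK /GRing.scale /= mulr1.
Qed.

Lemma measurable_marginal (a : S -> R) : L0plus a ->
  measurable_fun setT (fun s => marginal (U^~ s) (a s)).
Proof.
move=> [ma a0]; have [mU hU] := U_field.
(* The sign is changed because [measurable_fun_eval] asks for a non-decreasing field. *)
rewrite (_ : (fun s => _) = \- (fun s => - marginal (U^~ s) (a s)))%E; last first.
  by apply/funext => s; rewrite oppeK.
apply: measurableT_comp => //.
apply: (@measurable_fun_eval (fun c s => - marginal (U^~ s) c)%E) => //.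
- move=> q q0; apply: measurableT_comp => //.
  rewrite (_ : (fun s => _) = (fun s => (derive1 (fine \o U^~ s) q)%:E)).
    by apply/measurable_EFinP; apply: measurable_derivative.
  by apply/funext => s; apply: marginalE.
- by move=> s x y x0 xy; rewrite leeN2; apply: (marginal_le (hU s)).
- by move=> s x x0; apply: cvgeN; apply: (marginal_right_continuous (hU s)).
Qed.

End Fields.

Lemma measurable_demand (g : S -> R -> R) (w : R) (z : S -> R) :
  (forall s, inada (g s)) ->
  (forall q, 0 < q -> measurable_fun setT (g ^~ q)) ->
  0 <= w -> measurable_fun setT z -> (forall s, 0 < z s) ->
  measurable_fun setT (fun s => demand (g s) w (z s)).
Proof.
move=> g_inada mg w0 mz z0; apply: measurable_fun_lt => r.
have [r0|r0] := leP r 0.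
  rewrite (_ : [set s | _] = set0); first exact: measurable0.
  apply/seteqP; split=> s //=; rewrite ltNge => /negP; apply.
  by apply: le_trans r0 _; apply: demand_ge0.
rewrite (_ : [set s | _] = [set s | w * g s r < z s]).
  by apply: measurable_set_lt => //; apply: measurable_funM => //; apply: mg.
by apply/seteqP; split=> s /=; rewrite demand_lt.
Qed.

Lemma measurable_price (M : nat) (g : 'I_M -> S -> R -> R) (w : 'I_M -> R) (L : S -> R) :
  (forall i s, inada (g i s)) ->
  (forall i q, 0 < q -> measurable_fun setT ((g i) ^~ q)) ->
  simplex w -> measurable_fun setT L -> (forall s, 0 < L s) ->
  measurable_fun setT (fun s => price (g ^~ s) w (L s)).
Proof.
move=> g_inada mg sw mL L0; apply: measurable_fun_lt => r.
have [r0|r0] := leP r 0.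
  rewrite (_ : [set s | _] = set0); first exact: measurable0.
  apply/seteqP; split=> s //=; rewrite ltNge => /negP; apply.
  have [p0 _] := priceP (g_inada ^~ s) sw (L0 s).
  by apply: le_trans r0 _; apply: ltW.
rewrite (_ : [set s | _] = [set s | total_demand (g ^~ s) w r < L s]).
  apply: measurable_set_lt => //; rewrite /total_demand.
  apply: measurable_sum => i; apply: measurable_demand => //; first exact: mg.
  exact: sw.1.
by apply/seteqP; split=> s /=; rewrite price_lt.
Qed.

End Measurability.

(** * Integrals of extended real functions *)

Section Integral.
Context d (S : measurableType d) (R : realType).
Variable mu : {measure set S -> \bar R}.
Local Open Scope ereal_scope.
Implicit Types f g : S -> \bar R.

Lemma ae_le_funepos f g : {ae mu, forall s, f s <= g s} ->
  {ae mu, forall s, [set: S] s -> f^\+ s <= g^\+ s}.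
Proof.
apply: filterS => s fg _; rewrite !funeposE.
by rewrite ge_max !le_max fg lexx orbT.
Qed.

Lemma ae_le_funeneg f g : {ae mu, forall s, f s <= g s} ->
  {ae mu, forall s, [set: S] s -> g^\- s <= f^\- s}.
Proof.
apply: filterS => s fg _; rewrite !funenegE.
by rewrite ge_max !le_max leeN2 fg lexx orbT.
Qed.

(* No integrability is needed because [+oo - +oo = -oo] in [\bar R] and both
   sides are the difference of the integrals of the two parts. *)
Lemma ae_le_integral f g : measurable_fun setT f -> measurable_fun setT g ->
  {ae mu, forall s, f s <= g s} -> \int[mu]_s f s <= \int[mu]_s g s.
Proof.
move=> mf mg fg; rewrite [leLHS]integralE [leRHS]integralE; apply: leeB.
- apply: ae_ge0_le_integral => //; try exact: measurable_funepos.
  exact: ae_le_funepos.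
- apply: ae_ge0_le_integral => //; try exact: measurable_funeneg.
  exact: ae_le_funeneg.
Qed.

Lemma ae_le_integrable f g : measurable_fun setT f ->
  mu.-integrable setT g -> {ae mu, forall s, `|f s| <= `|g s|} ->
  mu.-integrable setT f.
Proof.
move=> mf /integrableP[mg ig] fg; apply/integrableP; split=> //.
apply: le_lt_trans ig; apply: ae_ge0_le_integral => //; try exact: measurableT_comp.
by apply: filterS fg.
Qed.

(** Integrability of [f] comes first: [f^\+] is below [g^\+], and an infinite integral of [f^\-]
    would make the integral of [f] equal to [-oo]. Then [g - f] is non-negative almost everywhere
    with integral zero. *)
Lemma ae_le_integral_eq f g : measurable_fun setT f -> mu.-integrable setT g ->
  {ae mu, forall s, f s <= g s} -> \int[mu]_s f s = \int[mu]_s g s ->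
  {ae mu, forall s, f s = g s}.
Proof.
move=> mf ig fg fgE; have mg : measurable_fun setT g by case/integrableP: ig.
have fpos : \int[mu]_s f^\+ s < +oo.
  apply: le_lt_trans (_ : \int[mu]_s g^\+ s < +oo).
    apply: ae_ge0_le_integral => //; try exact: measurable_funepos.
    exact: ae_le_funepos.
  by rewrite ltey_eq integrable_pos_fin_num.
have fneg : \int[mu]_s f^\- s < +oo.
  rewrite ltey; apply: contra_eq_neq fgE => foo.
  rewrite integralE foo addeC /=.
  by apply/eqP => gE; have := integrable_fin_num measurableT ig; rewrite -gE.
have fi : mu.-integrable setT f.
  apply/integrableP; split=> //.
  have -> : \int[mu]_s `|f s| = \int[mu]_s (f^\+ s + f^\- s).
    by apply: eq_integral => s _; rewrite -[LHS]/((abse \o f) s) fune_abse.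
  rewrite ge0_integralD //; [|exact: measurable_funepos|exact: measurable_funeneg].
  exact: lte_add_pinfty.
have h0 : \int[mu]_s `|g s - f s| = 0.
  transitivity (\int[mu]_s (g s - f s)).
    apply: ae_eq_integral => //.
    - apply: measurableT_comp => //. exact: emeasurable_funB mg mf.
    - exact: emeasurable_funB mg mf.
    - have gfin := integrable_ae measurableT ig.
      have ffin := integrable_ae measurableT fi.
      apply: filterS3 fg gfin ffin => s fgs gs fs _.
      by rewrite gee0_abs // sube_ge0 ?(gs I) ?orbT.
  rewrite (integralB measurableT ig fi) fgE subee //; exact: integrable_fin_num.
have mh : measurable_fun setT (fun s => g s - f s) by exact: emeasurable_funB mg mf.
have /ae_eq_integral_abs h := h0.
have gfin := integrable_ae measurableT ig.
have ffin := integrable_ae measurableT fi.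
apply: filterS3 (h measurableT mh) gfin ffin => s /(_ I) hs /(_ I) gs /(_ I) fs.
by apply/esym/eqP; rewrite -[f s]add0e -sube_eq ?hs // fin_num_adde_defl.
Qed.

End Integral.

(** * Existence of an equilibrium *)

Section Optimality.
Context d (S : measurableType d) (R : realType).
Variable mu : {measure set S -> \bar R}.

(** The integral of a measurable function that is not integrable is infinite, so the budget equation
    by itself makes the value of a trade integrable. *)
Lemma integrable_of_mean0 (f : S -> R) : measurable_fun setT f ->
  (\int[mu]_s (f s)%:E = 0)%E -> mu.-integrable setT (EFin \o f).
Proof.
move=> mf f0; apply/integrableP; split; first exact/measurable_EFinP.
by rewrite integral_fin_num_abs // f0.
Qed.

Variable V : R -> S -> \bar R.
Hypothesis V_field : utility_field V.

(** The tangent at [p] bounds [V] at a competitor [a] by [V] at [p] plus [h], the value of [a - p]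
    divided by [k]. The two budget equations give [h] mean zero. The tangent inequality is strict
    where [a] differs from [p], which yields uniqueness. *)
Lemma first_order_optimal (zeta a0 p : S -> R) (k : R) :
  0 < k -> measurable_fun setT zeta -> measurable_fun setT a0 ->
  measurable_fun setT p -> (forall s, 0 < p s) ->
  (forall s, zeta s = k * derive1 (fine \o V^~ s) (p s)) ->
  mu.-integrable setT (fun s => V (p s) s) ->
  (mean mu (fun s => (zeta s * (p s - a0 s))%:E) = 0)%E ->
  is_the_maximizer mu (budget mu zeta a0) V p.
Proof.
move=> k0 mzeta ma0 mp p0 zetaE iVp budget_p.
have pL0 : L0plus p by split=> // s; apply: ltW.
split=> // a [[ma a_ge0] budget_a].
have mphi (b : S -> R) : measurable_fun setT b ->
    measurable_fun setT (fun s => zeta s * (b s - a0 s)).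
  by move=> mb; apply: measurable_funM => //; apply: measurable_funB.
have ia := integrable_of_mean0 (mphi _ ma) budget_a.
have ip := integrable_of_mean0 (mphi _ mp) budget_p.
pose h s : \bar R := ((k^-1)%:E * ((zeta s * (a s - a0 s))%:E - (zeta s * (p s - a0 s))%:E))%E.
have iB : mu.-integrable setT
    (fun s => ((zeta s * (a s - a0 s))%:E - (zeta s * (p s - a0 s))%:E)%E).
  exact: (integrableB measurableT ia ip).
have ih : mu.-integrable setT h by apply: (integrableZl measurableT).
have h0 : (\int[mu]_s h s = 0)%E.
  rewrite /h (integralZl measurableT iB) (integralB measurableT ia ip).
  have -> : (\int[mu]_s (EFin \o (fun s => (zeta s * (a s - a0 s))%R)) s = 0)%E := budget_a.
  have -> : (\int[mu]_s (EFin \o (fun s => (zeta s * (p s - a0 s))%R)) s = 0)%E := budget_p.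
  by rewrite subee // mule0.
have hE s : h s = (derive1 (fine \o V^~ s) (p s) * (a s - p s))%:E.
  rewrite /h -EFinB -EFinM zetaE -mulrBr opprB addrA subrK.
  by congr EFin; rewrite -mulrA mulKf // gt_eqF.
have VpE s : V (p s) s = (fine (V (p s) s))%:E.
  by have [_ hV] := V_field; apply: (utility_EFin (hV s)).
have ig := integrableD measurableT iVp ih.
have gE : (\int[mu]_s (V (p s) s + h s) = \int[mu]_s V (p s) s)%E.
  by rewrite (integralD measurableT iVp ih) h0 adde0.
have tangent s : a s != p s -> (V (a s) s < V (p s) s + h s)%E.
  move=> aps; have [_ hV] := V_field.
  by rewrite hE VpE -EFinD; apply: (utility_tangent (hV s)).
have Va_le s : (V (a s) s <= V (p s) s + h s)%E.
  have [aps|/tangent/ltW//] := eqVneq (a s) (p s).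
  by rewrite hE aps subrr mulr0 adde0.
have mVa : measurable_fun setT (fun s => V (a s) s) by apply: measurable_utility.
have Va_ae : {ae mu, forall s, (V (a s) s <= V (p s) s + h s)%E} by apply: nearW.
split=> [|Vap].
  by rewrite /mean -gE; apply: ae_le_integral => //; case/integrableP: ig.
have /= := ae_le_integral_eq mVa ig Va_ae.
rewrite gE => /(_ Vap); apply: filterS => s /eqP; apply: contraTeq => /tangent.
by move=> /lt_eqF ->.
Qed.

End Optimality.

Section Weights.
Context d (S : measurableType d) (R : realType).
Variable mu : {measure set S -> \bar R}.
Variables (M : nat) (g : 'I_M -> S -> R -> R) (L : S -> R).
Hypothesis M_gt0 : (0 < M)%N.
Hypothesis g_inada : forall m s, inada (g m s).
Hypothesis mg : forall m q, 0 < q -> measurable_fun setT ((g m) ^~ q).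
Hypothesis mL : measurable_fun setT L.
Hypothesis L_gt0 : forall s, 0 < L s.

Definition state_price (w : 'I_M -> R) (s : S) : R := price (g ^~ s) w (L s).

Definition consumption (w : 'I_M -> R) (m : 'I_M) (s : S) : R :=
  demand (g m s) (w m) (state_price w s).

Lemma state_price_gt0 w s : simplex w -> 0 < state_price w s.
Proof. by move=> sw; have [] := priceP (g_inada ^~ s) sw (L_gt0 s). Qed.

Lemma sum_consumption w s : simplex w -> \sum_m consumption w m s = L s.
Proof. by move=> sw; have [] := priceP (g_inada ^~ s) sw (L_gt0 s). Qed.

Lemma consumption_ge0 w m s : simplex w -> 0 <= consumption w m s.
Proof. by move=> sw; apply: demand_ge0 => //; [apply: sw.1|apply: state_price_gt0]. Qed.

Lemma consumption_le w m s : simplex w -> consumption w m s <= L s.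
Proof.
move=> sw; rewrite -(sum_consumption s sw) (bigD1 m) //= lerDl sumr_ge0 // => i _.
exact: consumption_ge0.
Qed.

Lemma measurable_state_price w : simplex w -> measurable_fun setT (state_price w).
Proof. by move=> sw; apply: measurable_price. Qed.

Lemma measurable_consumption w m : simplex w -> measurable_fun setT (consumption w m).
Proof.
move=> sw; apply: measurable_demand => //.
- exact: mg.
- exact: sw.1.
- exact: measurable_state_price.
- by move=> s; apply: state_price_gt0.
Qed.

Variables (alpha0 : 'I_M -> S -> R) (G : S -> \bar R).
Hypothesis alpha0_L0 : forall m, L0plus (alpha0 m).
Hypothesis alpha0_sum : {ae mu, forall s, \sum_m alpha0 m s = L s}.
Hypothesis iG : mu.-integrable setT G.
Hypothesis G_dom :
  {ae mu, forall s, forall w, simplex w -> ((state_price w s * L s)%:E <= G s)%E}.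

Let excess w m s := (state_price w s * (consumption w m s - alpha0 m s))%:E.

Lemma measurable_excess w m : simplex w -> measurable_fun setT (excess w m).
Proof.
move=> sw; apply/measurable_EFinP; apply: measurable_funM.
  exact: measurable_state_price.
by apply: measurable_funB; [apply: measurable_consumption|have [] := alpha0_L0 m].
Qed.

Lemma excess_dominated :
  {ae mu, forall s, forall w m, simplex w -> (`|excess w m s| <= G s)%E}.
Proof.
apply: filterS2 alpha0_sum G_dom => s s0 sG w m sw; apply: le_trans (sG w sw).
have p0 := state_price_gt0 s sw.
rewrite /excess lee_fin normrM (gtr0_norm p0) ler_pM2l //.
have a0 : 0 <= alpha0 m s by have [_] := alpha0_L0 m.
have aL : alpha0 m s <= L s.
  rewrite -s0 (bigD1 m) //= lerDl sumr_ge0 // => i _.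
  by have [_] := alpha0_L0 i.
have := consumption_ge0 m s sw; have := consumption_le m s sw.
by rewrite ler_norml => h1 h2; apply/andP; split; lra.
Qed.

Lemma integrable_excess w m : simplex w -> mu.-integrable setT (excess w m).
Proof.
move=> sw; apply: (ae_le_integrable (measurable_excess m sw) iG).
by apply: filterS excess_dominated => s sG; apply: le_trans (sG w m sw) (lee_abs _).
Qed.

Lemma cvg_integral_excess (w_ : nat -> 'I_M -> R) (w : 'I_M -> R) m :
  (forall n, simplex (w_ n)) -> simplex w ->
  (forall i, w_ n i @[n --> \oo] --> w i) ->
  fine (\int[mu]_s excess (w_ n) m s) @[n --> \oo] --> fine (\int[mu]_s excess w m s).
Proof.
move=> sw_ sw w_w; apply: fine_cvg; rewrite fineK; last first.
  by apply: integrable_fin_num => //; apply: integrable_excess.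
have [] // := @dominated_convergence _ _ _ mu setT measurableT
  (fun n => excess (w_ n) m) (excess w m) G.
- by move=> n; apply: measurable_excess.
- exact: measurable_excess.
- apply: nearW => s _; apply: cvg_EFin; first exact: nearW.
  have cp : state_price (w_ n) s @[n --> \oo] --> state_price w s.
    exact: cvg_price.
  apply: cvgM => //; apply: cvgB; last exact: cvg_cst.
  apply: cvg_demand => //; [exact: sw.1|exact: state_price_gt0|].
  by apply: nearW => n; apply: (sw_ n).1.
- by apply: filterS excess_dominated => s sG n _; apply: sG.
Qed.

Lemma exists_weights : (forall m, ~ {ae mu, forall s, alpha0 m s = 0}) ->
  exists w, [/\ simplex w, forall m, 0 < w m &
    forall m, (\int[mu]_s excess w m s = 0)%E].
Proof.
move=> alpha0_neq0.
have [|||w sw fw] := @simplex_zero R M (fun w m => fine (\int[mu]_s excess w m s)) M_gt0.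
- by move=> w_ w sw_ sw w_w m; apply: cvg_integral_excess.
- move=> w sw; apply/EFin_inj; rewrite -sumEFin.
  transitivity (\sum_m \int[mu]_s excess w m s)%E.
    apply: eq_bigr => m _; rewrite fineK //.
    by apply: integrable_fin_num => //; apply: integrable_excess.
  rewrite -(@integral_sum _ _ _ mu setT measurableT _ (fun m => excess w m)); last first.
    by move=> m; apply: integrable_excess.
  have ms : measurable_fun setT (fun s => \sum_m excess w m s)%E.
    by apply: emeasurable_sum => m; apply: measurable_excess.
  rewrite (ae_eq_integral (cst 0%E)) ?integral0 //.
  apply: filterS alpha0_sum => s s0 _; rewrite /excess sumEFin -mulr_sumr sumrB.
  by rewrite sum_consumption // s0 subrr mulr0.
- move=> w m sw wm0; apply: fine_le0; rewrite -[leRHS](integral0 mu setT).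
  apply: ae_le_integral => //; first exact: measurable_excess.
  apply: nearW => s; rewrite lee_fin mulr_ge0_le0 ?(ltW (state_price_gt0 s sw)) //.
  rewrite /consumption wm0 demand0 ?state_price_gt0 // sub0r oppr_le0.
  by have [_] := alpha0_L0 m.
have w0 m : (\int[mu]_s excess w m s = 0)%E.
  by rewrite -[LHS]fineK ?fw //; apply: integrable_fin_num => //; apply: integrable_excess.
exists w; split=> // m; have [w_ge0 _] := sw.
(* With weight zero the agent consumes nothing and the excess is minus the value of the endowment;
   having mean zero, it would make the endowment zero. *)
rewrite lt_neqAle w_ge0 andbT eq_sym; apply/eqP => wm0.
apply: (alpha0_neq0 m).
have exE s : excess w m s = (- (state_price w s * alpha0 m s))%:E.
  by rewrite /excess /consumption wm0 demand0 ?state_price_gt0 // sub0r mulrN.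
have ex_le0 : {ae mu, forall s, (excess w m s <= 0)%E}.
  apply: nearW => s; rewrite exE lee_fin oppr_le0 mulr_ge0 ?(ltW (state_price_gt0 s sw)) //.
  by have [_] := alpha0_L0 m.
have ex0 : {ae mu, forall s, (excess w m s = 0)%E}.
  apply: (ae_le_integral_eq _ _ ex_le0); first exact: measurable_excess.
    exact: integrable0.
  by rewrite w0 integral0.
apply: filterS ex0 => s; rewrite exE => /eqP; rewrite eqe oppr_eq0 mulf_eq0.
by rewrite gt_eqF ?state_price_gt0 //= => /eqP.
Qed.

End Weights.

Section Sufficiency.
Context d (S : measurableType d) (R : realType).
Variable mu : {measure set S -> \bar R}.
Variables (M : nat) (U : 'I_M -> R -> S -> \bar R).
Variables (Lambda : S -> R) (alpha0 : 'I_M -> S -> R).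
Hypothesis U_field : forall m, utility_field (U m).
Hypothesis Lambda_L0 : L0plus Lambda.
Hypothesis Lambda_gt0 : {ae mu, forall s, 0 < Lambda s}.

Lemma marginal_Lambda_ge0 m (a : S -> R) s : L0plus a ->
  (0 <= marginal ((U m)^~ s) (a s) * (Lambda s)%:E)%E.
Proof.
move=> [_ a0]; have [_ hU] := U_field m; have [_ Lambda0] := Lambda_L0.
by rewrite mule_ge0 ?lee_fin // ltW // (marginal_gt0 (hU s)).
Qed.

Lemma measurable_marginal_Lambda m (a : S -> R) : L0plus a ->
  measurable_fun setT (fun s => marginal ((U m)^~ s) (a s) * (Lambda s)%:E)%E.
Proof.
move=> aL0; apply: emeasurable_funM; first exact: measurable_marginal.
by apply/measurable_EFinP; case: Lambda_L0.
Qed.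

Lemma sufficiency_integrable m (a : S -> R) : L0plus a ->
  (mean mu (fun s => `|U m (a s) s| + marginal ((U m)^~ s) (a s) * (Lambda s)%:E)
     < +oo)%E <->
  mu.-integrable setT (fun s => U m (a s) s) /\
  mu.-integrable setT (fun s => marginal ((U m)^~ s) (a s) * (Lambda s)%:E)%E.
Proof.
move=> aL0; have mUa := measurable_utility (U_field m) aL0.
have mh := measurable_marginal_Lambda m aL0.
have h0 s := marginal_Lambda_ge0 m s aL0.
have mabs : measurable_fun setT (fun s => `|U m (a s) s|)%E by apply: measurableT_comp.
rewrite /mean ge0_integralD //; split=> [fin|[iU ih]].
- have [fin1 fin2] : (\int[mu]_s `|U m (a s) s| < +oo)%E /\
      (\int[mu]_s (marginal ((U m)^~ s) (a s) * (Lambda s)%:E) < +oo)%E.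
    split; apply: le_lt_trans fin; first by rewrite leeDl // integral_ge0.
    by rewrite leeDr // integral_ge0.
  split; apply/integrableP; split=> //.
  by under eq_integral => s _ do rewrite gee0_abs //.
- apply: lte_add_pinfty; first by case/integrableP: iU.
  by rewrite ltey_eq integrable_fin_num.
Qed.

(** An integrable function is finite almost everywhere, whereas the product is [+oo] where [a]
    vanishes and [Lambda] is positive. *)
Lemma marginal_Lambda_gt0 m (a : S -> R) : L0plus a ->
  mu.-integrable setT (fun s => marginal ((U m)^~ s) (a s) * (Lambda s)%:E)%E ->
  {ae mu, forall s, 0 < a s}.
Proof.
move=> [_ a0] ih; have fin := integrable_ae measurableT ih.
apply: filterS2 Lambda_gt0 fin => s Ls /(_ I); rewrite lt_neqAle a0 andbT eq_sym.
by apply: contraTneq => ->; rewrite /marginal eqxx gt0_mulye ?lte_fin.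
Qed.

Hypothesis M_gt0 : (0 < M)%N.
Hypothesis alpha0_alloc : allocation mu Lambda alpha0.
Hypothesis alpha0_neq0 : forall m, ~ {ae mu, forall s, alpha0 m s = 0}.

Lemma equilibrium_exists (alpha : 'I_M -> S -> R) :
  allocation mu Lambda alpha ->
  (forall m, mean mu (fun s =>
     `|U m (alpha m s) s| + marginal ((U m)^~ s) (alpha m s) * (Lambda s)%:E)
       < +oo)%E ->
  exists (zeta : S -> R) (alpha1 : 'I_M -> S -> R),
    arrow_debreu_equilibrium mu U Lambda alpha0 zeta alpha1.
Proof.
move=> [alpha_L0 alpha_sum] alpha_fin.
have iU m : mu.-integrable setT (fun s => U m (alpha m s) s).
  by have [] := (sufficiency_integrable m (alpha_L0 m)).1 (alpha_fin m).
pose h m s := (marginal ((U m)^~ s) (alpha m s) * (Lambda s)%:E)%E.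
have ih m : mu.-integrable setT (h m).
  by have [] := (sufficiency_integrable m (alpha_L0 m)).1 (alpha_fin m).
have alpha_gt0 : {ae mu, forall s, forall m, 0 < alpha m s}.
  by apply: filter_forall => m; apply: (marginal_Lambda_gt0 (alpha_L0 m) (ih m)).
have [mLambda Lambda_ge0] := Lambda_L0.
(* A version of [Lambda] that is positive in every state, so that prices and demands are
   characterized everywhere. *)
pose L s := if 0 < Lambda s then Lambda s else 1.
have mL : measurable_fun setT L.
  apply: measurable_fun_ifT => //; apply: (measurable_fun_bool true) => //.
  by rewrite setTI; apply: (@measurable_set_lt _ _ _ (cst 0)).
have L_gt0 s : 0 < L s by rewrite /L; case: ifP.
have LE : {ae mu, forall s, L s = Lambda s} by apply: filterS Lambda_gt0 => s; rewrite /L => ->.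
pose g m s := derive1 (fine \o (U m)^~ s).
have g_inada m s : inada (g m s) by have [_ hU] := U_field m; apply: utility_inada.
have mg m q : 0 < q -> measurable_fun setT ((g m)^~ q).
  by move=> q0; apply: measurable_derivative.
have hE m s : 0 < alpha m s -> h m s = (g m s (alpha m s) * Lambda s)%:E.
  by move=> a0; rewrite /h marginalE.
pose G s := (\sum_m h m s)%E.
have iG : mu.-integrable setT G by apply: integrable_sum => // m _; apply: ih.
have G_dom : {ae mu, forall s, forall w, simplex w ->
    ((state_price g L w s * L s)%:E <= G s)%E}.
  apply: filterS3 alpha_sum LE alpha_gt0 => s sum_s Ls as0 w sw.
  rewrite /G (eq_bigr (fun m => (g m s (alpha m s) * Lambda s)%:E)); last first.
    by move=> m _; apply: hE.
  rewrite sumEFin lee_fin -mulr_suml -Ls ler_pM2r //.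
  by apply: (price_le (fun m => g_inada m s)) => //; rewrite Ls.
have alpha0_sum : {ae mu, forall s, \sum_m alpha0 m s = L s}.
  by have [_] := alpha0_alloc; apply: filterS2 LE => s ->.
have [w [sw w_gt0 w_budget]] := exists_weights M_gt0 g_inada mg mL L_gt0
  alpha0_alloc.1 alpha0_sum iG G_dom alpha0_neq0.
pose zeta := state_price g L w; pose pi := consumption g L w.
have zeta_gt0 s : 0 < zeta s by apply: state_price_gt0.
have mzeta : measurable_fun setT zeta by apply: measurable_state_price.
have pi_gt0 m s : 0 < pi m s by have [] := demandP (g_inada m s) (w_gt0 m) (zeta_gt0 s).
have zetaE m s : zeta s = w m * g m s (pi m s).
  by have [] := demandP (g_inada m s) (w_gt0 m) (zeta_gt0 s).
have mpi m : measurable_fun setT (pi m) by apply: measurable_consumption.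
have izeta : mu.-integrable setT (fun s => (zeta s * Lambda s)%:E).
  apply: (ae_le_integrable _ iG).
    by apply/measurable_EFinP; apply: measurable_funM.
  apply: filterS2 LE G_dom => s <- /(_ w sw) Gs; rewrite gee0_abs.
    by apply: le_trans (lee_abs _).
  by rewrite lee_fin ltW // mulr_gt0.
(* The tangents at [alpha m] and at [pi m] bound the utility of [pi m] from above and below. The
   error terms are at most marginal utility times [Lambda]; at [pi m] this is [zeta * Lambda]
   divided by [w m]. *)
have iUpi m : mu.-integrable setT (fun s => U m (pi m s) s).
  have iB := integrableD measurableT
    (integrableD measurableT (integrable_abse (iU m)) (ih m))
    (integrableZl measurableT (w m)^-1 izeta).
  apply: (ae_le_integrable _ iB).
    by apply: measurable_utility => //; split=> // s; apply: ltW.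
  apply: filterS3 alpha_sum LE alpha_gt0 => s sum_s Ls as0.
  have [_ hU] := U_field m.
  have alphaL : alpha m s <= Lambda s.
    by rewrite -sum_s (bigD1 m) //= lerDl sumr_ge0 // => i _; apply: ltW.
  have piL : pi m s <= Lambda s by rewrite -Ls; apply: consumption_le.
  have Ls0 : 0 < Lambda s by rewrite -Ls.
  apply: le_trans (lee_abs _).
  rewrite /= hE // (utility_EFin (hU s) (pi_gt0 m s)) (utility_EFin (hU s) (as0 m)).
  rewrite -EFinM -!EFinD lee_fin.
  have zg : (w m)^-1 * (zeta s * Lambda s) = g m s (pi m s) * Lambda s.
    by rewrite (zetaE m) -mulrA mulKf // gt_eqF.
  rewrite zg.
  have := concave_tangent_le (utility_concave (hU s)) (as0 m) (pi_gt0 m s)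
    (utility_derivable (hU s) (as0 m)).
  have := concave_tangent_le (utility_concave (hU s)) (pi_gt0 m s) (as0 m)
    (utility_derivable (hU s) (pi_gt0 m s)).
  have ga0 : 0 < g m s (alpha m s) by have [h1 _ _] := g_inada m s; apply: h1.
  have gp0 : 0 < g m s (pi m s) by have [h1 _ _] := g_inada m s; apply: h1.
  have : g m s (alpha m s) * (pi m s - alpha m s) <= g m s (alpha m s) * Lambda s.
    by rewrite ler_pM2l // lerBlDr ler_wpDr // ltW.
  have : g m s (pi m s) * (alpha m s - pi m s) <= g m s (pi m s) * Lambda s.
    by rewrite ler_pM2l // lerBlDr ler_wpDr // ltW.
  have : 0 < g m s (alpha m s) * Lambda s by rewrite mulr_gt0.
  have : 0 < g m s (pi m s) * Lambda s by rewrite mulr_gt0.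
  rewrite -/(g m s) /=; set a := fine (U m (alpha m s) s); set p := fine _.
  set x1 := g m s (pi m s) * Lambda s; set x2 := g m s (alpha m s) * Lambda s.
  move=> h1 h2 h3 h4 h5 h6.
  have := ler_norm a; have := ler_norm (- a); rewrite normrN ler_norml => h7 h8.
  by apply/andP; split; lra.
exists zeta, pi; split=> //.
- by apply: nearW.
- split=> [m|]; first by split=> // s; apply: ltW.
  by apply: filterS LE => s <-; exact: (sum_consumption g_inada L_gt0 s sw).
- by rewrite ltey_eq integrable_fin_num.
- by move=> m; have /integrableP[] := iUpi m.
- move=> m; apply: (first_order_optimal (U_field m) (w_gt0 m)) => //.
    by have [/(_ m)[ma0 _] _] := alpha0_alloc.
  exact: w_budget.
Qed.

End Sufficiency.

(** * First-order conditions in equilibrium *)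

Section Necessity.
Context d (S : measurableType d) (R : realType).
Variable mu : {measure set S -> \bar R}.

Lemma ae_eq0_of_mean0 (f : S -> R) : measurable_fun setT f ->
  {ae mu, forall s, 0 <= f s} -> (\int[mu]_s (f s)%:E = 0)%E ->
  {ae mu, forall s, f s = 0}.
Proof.
move=> mf f0 int0; have i_f := integrable_of_mean0 mf int0.
have f0E : {ae mu, forall s, (cst 0 s <= (EFin \o f) s)%E}.
  by apply: filterS f0 => s; rewrite /= lee_fin.
have /= := ae_le_integral_eq (@measurable_cst _ _ _ _ setT 0%E) i_f f0E.
by rewrite integral0 => /(_ (esym int0)); apply: filterS => s [<-].
Qed.

Variable V : R -> S -> \bar R.
Hypothesis V_field : utility_field V.
Variables (zeta a0 p Lambda : S -> R).
Hypothesis mzeta : measurable_fun setT zeta.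
Hypothesis zeta_gt0 : {ae mu, forall s, 0 < zeta s}.
Hypothesis a0_L0 : L0plus a0.
Hypothesis Lambda_L0 : L0plus Lambda.
Hypothesis Lambda_gt0 : {ae mu, forall s, 0 < Lambda s}.
Hypothesis p_le : {ae mu, forall s, p s <= Lambda s}.
Hypothesis a0_neq0 : ~ {ae mu, forall s, a0 s = 0}.
Hypothesis zetaLambda_fin : (mean mu (fun s => (zeta s * Lambda s)%:E) < +oo)%E.
Hypothesis iVp : mu.-integrable setT (fun s => V (p s) s).
Hypothesis p_max : is_the_maximizer mu (budget mu zeta a0) V p.

Let p_L0 : L0plus p. Proof. by have [[]] := p_max. Qed.
Let p_budget : (\int[mu]_s (zeta s * (p s - a0 s))%:E = 0)%E.
Proof. by have [[]] := p_max. Qed.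

Lemma integrable_value (x : S -> R) : measurable_fun setT x ->
  {ae mu, forall s, 0 <= x s <= Lambda s} ->
  mu.-integrable setT (fun s => (zeta s * x s)%:E).
Proof.
move=> mx x_le; have [mLambda _] := Lambda_L0.
have mzL : measurable_fun setT (fun s => (zeta s * Lambda s)%:E).
  by apply/measurable_EFinP; apply: measurable_funM.
have iL : mu.-integrable setT (fun s => (zeta s * Lambda s)%:E).
  apply/integrableP; split=> //; apply: le_lt_trans zetaLambda_fin.
  apply: ae_le_integral => //; first exact: measurableT_comp.
  apply: filterS2 zeta_gt0 Lambda_gt0 => s z0 L0.
  by rewrite gee0_abs // lee_fin ltW // mulr_gt0.
apply: (ae_le_integrable _ iL); first by apply/measurable_EFinP; apply: measurable_funM.
apply: filterS2 zeta_gt0 x_le => s z0 /andP[x0 xL]; rewrite /= lee_fin !normrM.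
by rewrite ler_pM2l ?normr_gt0 ?gt_eqF // (ger0_norm x0) (ger0_norm (le_trans x0 xL)).
Qed.

(* A small trade that sells [y] to buy [x] would be profitable unless [x] is
   worthless. *)
Lemma no_profitable_trade (r : R) (x y : S -> R) :
  measurable_fun setT x -> measurable_fun setT y ->
  (forall s, 0 <= x s <= Lambda s) -> (forall s, 0 <= y s <= p s) ->
  {ae mu, forall s, x s = 0 \/ y s = 0} ->
  {ae mu, forall s, forall t, 0 < t < 1 ->
    (V (p s) s + ((r + 1) * (t * (zeta s * x s)))%:E <= V (p s + t * x s) s)%E} ->
  {ae mu, forall s, forall t, 0 < t < 1 ->
    (V (p s) s - (r * (t * (zeta s * y s)))%:E <= V (p s - t * y s) s)%E} ->
  (0 < \int[mu]_s (zeta s * y s)%:E)%E ->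
  (\int[mu]_s (zeta s * x s)%:E = 0)%E.
Proof.
move=> mx my x_le y_le xy0 buy sell cy_gt0.
have ix : mu.-integrable setT (fun s => (zeta s * x s)%:E).
  by apply: integrable_value => //; apply: nearW.
have iy : mu.-integrable setT (fun s => (zeta s * y s)%:E).
  apply: integrable_value => //; apply: filterS p_le => s ps.
  by have /andP[-> /le_trans->] := y_le s.
have [cx cxE] : exists c, (\int[mu]_s (zeta s * x s)%:E = c%:E)%E.
  by exists (fine (\int[mu]_s (zeta s * x s)%:E)); rewrite fineK // integrable_fin_num.
have [cy cyE] : exists c, (\int[mu]_s (zeta s * y s)%:E = c%:E)%E.
  by exists (fine (\int[mu]_s (zeta s * y s)%:E)); rewrite fineK // integrable_fin_num.
rewrite cxE; congr EFin; apply/eqP; rewrite eq_le andbC; apply/andP; split.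
  rewrite -lee_fin -cxE -[leLHS](integral0 mu setT); apply: ae_le_integral => //.
    by case/integrableP: ix.
  apply: filterS zeta_gt0 => s z0; rewrite lee_fin mulr_ge0 ?(ltW z0) //.
  by have /andP[] := x_le s.
rewrite leNgt; apply/negP => cx0; rewrite cyE lte_fin in cy_gt0.
(* With these fractions, both below 1, purchase and sale have the same value [cx * cy / (cx + cy)],
   so the trade stays within the budget. *)
pose tx := cy / (cx + cy); pose ty := cx / (cx + cy).
have cxy : 0 < cx + cy by rewrite addr_gt0.
have tx01 : 0 < tx < 1 by rewrite divr_gt0 //= ltr_pdivrMr // mul1r ltrDr.
have ty01 : 0 < ty < 1 by rewrite divr_gt0 //= ltr_pdivrMr // mul1r ltrDl.
have txy : tx * cx = ty * cy by rewrite /tx /ty mulrAC [cy * cx]mulrC mulrAC.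
pose a s := p s + (tx * x s - ty * y s).
have [mp p_ge0] := p_L0; have [ma0 _] := a0_L0.
have a_L0 : L0plus a.
  split; first by apply: measurable_funD => //; apply: measurable_funB; apply: measurable_funM.
  move=> s; have /andP[x0 _] := x_le s; have /andP[y0 yp] := y_le s.
  have /andP[tx0 _] := tx01; have /andP[ty0 ty1] := ty01.
  have : 0 <= tx * x s by rewrite mulr_ge0 // ltW.
  have : ty * y s <= y s by rewrite ler_piMl // ltW.
  by rewrite /a; lra.
pose trade s := (tx%:E * (zeta s * x s)%:E - ty%:E * (zeta s * y s)%:E)%E.
have itx := integrableZl measurableT tx ix.
have ity := integrableZl measurableT ty iy.
have itrade : mu.-integrable setT trade := integrableB measurableT itx ity.
have trade0 : (\int[mu]_s trade s = 0)%E.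
  rewrite (integralB measurableT itx ity) (integralZl measurableT ix).
  by rewrite (integralZl measurableT iy) cxE cyE -!EFinM -EFinB txy subrr.
have a_budget : budget mu zeta a0 a.
  split=> //; have ip0 : mu.-integrable setT (EFin \o (fun s => zeta s * (p s - a0 s))).
    by apply: integrable_of_mean0 => //; apply: measurable_funM => //; apply: measurable_funB.
  have -> : (fun s => (zeta s * (a s - a0 s))%:E) =
      (fun s => (EFin \o (fun s => (zeta s * (p s - a0 s))%R)) s + trade s)%E.
    apply/funext => s; rewrite /trade /= -!EFinM -EFinB -EFinD; congr EFin.
    by rewrite /a !(mulrBr, mulrDr) ![zeta s * (_ * _)]mulrCA; lra.
  by rewrite /mean (integralD measurableT ip0 itrade) trade0 adde0.
pose gain s := ((r + 1)%:E * (tx%:E * (zeta s * x s)%:E) - r%:E * (ty%:E * (zeta s * y s)%:E))%E.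
have igx := integrableZl measurableT (r + 1) itx.
have igy := integrableZl measurableT r ity.
have igain : mu.-integrable setT gain := integrableB measurableT igx igy.
have gainE : (\int[mu]_s gain s = (tx * cx)%:E)%E.
  rewrite (integralB measurableT igx igy) (integralZl measurableT itx).
  rewrite (integralZl measurableT ity) (integralZl measurableT ix).
  rewrite (integralZl measurableT iy) cxE cyE -!EFinM -EFinB -txy.
  by congr EFin; lra.
have Va_ge : {ae mu, forall s, (V (p s) s + gain s <= V (a s) s)%E}.
  (* No state sees both a purchase and a sale, so one of the two estimates suffices in each
     state. *)
  apply: filterS3 xy0 buy sell => s [xs0|ys0] /(_ _ tx01) buy_s /(_ _ ty01) sell_s.
  - by move: sell_s; rewrite /gain /a xs0 !mulr0 !mule0 sub0r sub0e -!EFinM.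
  - by move: buy_s; rewrite /gain /a ys0 !mulr0 !mule0 subr0 sube0 -!EFinM.
have [_ /(_ a a_budget)[Va_le _]] := p_max.
move: Va_le; rewrite /mean => Va_le.
have : (\int[mu]_s (V (p s) s + gain s) <= \int[mu]_s V (p s) s)%E.
  apply: le_trans Va_le; apply: ae_le_integral => //.
    by have /integrableP[] := integrableD measurableT iVp igain.
  exact: measurable_utility.
rewrite (integralD measurableT iVp igain) gainE.
rewrite -[leRHS]adde0 leeD2lE ?integrable_fin_num // lee_fin leNgt.
by rewrite mulr_gt0 //; case/andP: tx01.
Qed.

(* The agent sells half of his consumption where his marginal utility is low
   relative to the price, and buys where it is high. *)
Let sale r s : R :=
  if (marginal (V^~ s) (p s / 2) < (r * zeta s)%:E)%E then p s / 2 else 0.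

Let purchase r k s : R :=
  if (((r + 1) * zeta s)%:E < marginal (V^~ s) (p s + Lambda s / k.+1%:R))%E
  then Lambda s / k.+1%:R else 0.

Let p2_L0 : L0plus (fun s => p s / 2).
Proof.
have [mp p0] := p_L0; split=> [|s]; last by rewrite divr_ge0.
exact: measurable_funM.
Qed.

Let pk_L0 k : L0plus (fun s => p s + Lambda s / k.+1%:R).
Proof.
have [mp p0] := p_L0; have [mL L0] := Lambda_L0; split=> [|s].
  by apply: measurable_funD => //; apply: measurable_funM.
by rewrite addr_ge0 // divr_ge0.
Qed.

Let measurable_sale r : measurable_fun setT (sale r).
Proof.
apply: measurable_fun_ifT => //; last by have [] := p2_L0.
apply: measurable_fun_lte; first exact: measurable_marginal.
by apply/measurable_EFinP; apply: measurable_funM.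
Qed.

Let measurable_purchase r k : measurable_fun setT (purchase r k).
Proof.
apply: measurable_fun_ifT => //.
  apply: measurable_fun_lte; last exact: measurable_marginal.
  by apply/measurable_EFinP; apply: measurable_funM.
by have [mL _] := Lambda_L0; apply: measurable_funM.
Qed.

Let sale_le r s : 0 <= sale r s <= p s.
Proof. by have [_ /(_ s) p0] := p_L0; rewrite /sale; case: ifP => _; lra. Qed.

Let purchase_le r k s : 0 <= purchase r k s <= Lambda s.
Proof.
have [_ /(_ s) L0] := Lambda_L0; rewrite /purchase; case: ifP => _; last by rewrite lexx L0.
by rewrite divr_ge0 //= ler_piMr // invf_le1 ?ltr0n // ler1n.
Qed.

(** [purchase] tests the marginal utility at the end of the full trade, so after a partial trade it
    is at least as large. The tangent is taken at the consumption after the trade because [p s] may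
    be zero. *)
Lemma buyer_gain r k : {ae mu, forall s, forall t, 0 < t < 1 ->
  (V (p s) s + ((r + 1) * (t * (zeta s * purchase r k s)))%:E
     <= V (p s + t * purchase r k s) s)%E}.
Proof.
apply: filterS Lambda_gt0 => s L0 t /andP[t0 t1].
have [_ hV] := V_field; have [_ /(_ s) p0] := p_L0.
rewrite /purchase; case: ifPn => [gt|_]; last by rewrite !mulr0 !addr0.
set x := Lambda s / _ in gt *.
have x0 : 0 < x by rewrite divr_gt0.
have tx0 : 0 < t * x by rewrite mulr_gt0.
have q0 : 0 < p s + t * x by rewrite ltr_wpDl.
have gq : (r + 1) * zeta s < derive1 (fine \o V^~ s) (p s + t * x).
  rewrite -lte_fin -marginalE //; apply: lt_le_trans gt _.
  by apply: (marginal_le (hV s)); rewrite ?(ltW q0) // lerD2l ler_piMl // ltW.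
have pq : p s != p s + t * x by rewrite lt_eqF // ltrDl.
have := utility_tangent (hV s) q0 p0 pq => /ltW /(leeD2r ((r + 1) * (t * (zeta s * x)))%:E).
move=> /le_trans; apply; rewrite -EFinD [leRHS](utility_EFin (hV s) q0) lee_fin.
set g := derive1 _ _ in gq *.
have : 0 < t * x * (g - (r + 1) * zeta s) by rewrite mulr_gt0 // subr_gt0.
have -> : p s - (p s + t * x) = - (t * x) by lra.
by move: (fine _) => v; rewrite !mulrBr !mulrDl; nra.
Qed.

(** More than [p s / 2] is kept, so after the sale the marginal utility is at most the one tested in
    [sale]. Since [marginal] is [+oo] at 0, a sale takes place only where [p s] is positive. *)
Lemma seller_gain r : {ae mu, forall s, forall t, 0 < t < 1 ->
  (V (p s) s - (r * (t * (zeta s * sale r s)))%:E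
     <= V (p s - t * sale r s) s)%E}.
Proof.
apply: nearW => s t /andP[t0 t1].
have [_ hV] := V_field; have [_ /(_ s) p0] := p_L0.
rewrite /sale; case: ifPn => [lt|_]; last by rewrite !mulr0 subr0 sube0.
have {}p0 : 0 < p s.
  rewrite lt_neqAle p0 andbT; apply: contraTneq lt => <-.
  by rewrite mul0r /marginal eqxx -leNgt leey.
set y := p s / 2 in lt *.
have y0 : 0 < y by rewrite divr_gt0.
have py : p s = y + y by rewrite /y; lra.
have ty0 : 0 < t * y by rewrite mulr_gt0.
have tyy : t * y < y by rewrite gtr_pMl.
have q0 : 0 < p s - t * y by lra.
have gq : derive1 (fine \o V^~ s) (p s - t * y) < r * zeta s.
  rewrite -lte_fin -marginalE //; apply: le_lt_trans lt.
  by apply: (marginal_le (hV s)); lra.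
have := concave_tangent_le (utility_concave (hV s)) q0 p0 (utility_derivable (hV s) q0).
rewrite (utility_EFin (hV s) p0) (utility_EFin (hV s) q0) -EFinB lee_fin /=.
set g := derive1 _ _ in gq *.
have : 0 < t * y * (r * zeta s - g) by rewrite mulr_gt0 // subr_gt0.
have -> : p s - (p s - t * y) = t * y by lra.
move: (fine (V (p s) s)) (fine _) => v1 v2; rewrite mulrBr; nra.
Qed.

(** Where [p s] is positive the marginal utility at [p s / 2] is finite, hence below [n%:R * zeta s]
    for some [n]. If no [n] led to sales of positive value, [p] would vanish almost everywhere, and
    the budget equation would make [a0] vanish too. *)
Lemma exists_seller : exists n,
  (0 < \int[mu]_s (zeta s * sale n%:R s)%:E)%E.
Proof.
apply/not_existsP => no_seller; apply: a0_neq0.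
have hp0 n : {ae mu, forall s, zeta s * sale n%:R s = 0}.
  have ge0 : {ae mu, forall s, 0 <= zeta s * sale n%:R s}.
    apply: filterS zeta_gt0 => s z0; rewrite mulr_ge0 ?(ltW z0) //.
    by have /andP[] := sale_le n%:R s.
  have mf : measurable_fun setT (fun s => zeta s * sale n%:R s).
    by apply: measurable_funM.
  apply: ae_eq0_of_mean0 => //; apply/eqP; rewrite eq_le; apply/andP; split.
    by rewrite leNgt; apply/negP/no_seller.
  rewrite -[leLHS](integral0 mu setT); apply: ae_le_integral => //.
    exact/measurable_EFinP.
have p0 : {ae mu, forall s, p s = 0}.
  apply: filterS2 zeta_gt0 (ae_foralln hp0) => s z0 hp.
  have [_ /(_ s)] := p_L0; rewrite le_eqVlt => /predU1P[//|p_gt0].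
  have p2 : 0 < p s / 2 by rewrite divr_gt0.
  pose g := derive1 (fine \o V^~ s) (p s / 2).
  have [n gn] : exists n : nat, g / zeta s < n%:R.
    by exists (Num.bound `|g / zeta s|); apply: le_lt_trans (ler_norm _) (archi_boundP _).
  have := hp n; rewrite /sale marginalE // lte_fin -ltr_pdivrMr // gn.
  by move/eqP; rewrite mulf_eq0 (gt_eqF z0) (gt_eqF p2).
have ma0 : measurable_fun setT a0 by case: a0_L0.
have mphi : measurable_fun setT (fun s => (zeta s * (p s - a0 s))%:E).
  have [mp _] := p_L0.
  by apply/measurable_EFinP; apply: measurable_funM => //; apply: measurable_funB.
have phi_le0 : {ae mu, forall s, ((zeta s * (p s - a0 s))%:E <= cst 0 s)%E}.
  apply: filterS2 zeta_gt0 p0 => s z0 ->.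
  have [_ /(_ s) a0_ge0] := a0_L0.
  by rewrite lee_fin sub0r mulrN oppr_le0 mulr_ge0 // ltW.
have := ae_le_integral_eq mphi (integrable0 mu setT) phi_le0.
rewrite p_budget integral0 => /(_ erefl); apply: filterS3 zeta_gt0 p0 => s z0 -> [].
by move=> /eqP; rewrite sub0r mulrN oppr_eq0 mulf_eq0 gt_eqF //= => /eqP.
Qed.

Lemma integrable_marginal_Lambda :
  mu.-integrable setT (fun s => marginal (V^~ s) (p s) * (Lambda s)%:E)%E.
Proof.
have [n seller] := exists_seller; have [mL L_ge0] := Lambda_L0; have [_ hV] := V_field.
have p_ge0 s : 0 <= p s by have [_] := p_L0.
have buy0 k : {ae mu, forall s, zeta s * purchase n%:R k s = 0}.
  apply: ae_eq0_of_mean0; first exact: measurable_funM.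
    apply: filterS zeta_gt0 => s z0; rewrite mulr_ge0 ?(ltW z0) //.
    by have /andP[] := purchase_le n%:R k s.
  apply: (@no_profitable_trade n%:R (purchase n%:R k) (sale n%:R)) => //.
  (* The marginal utility after a purchase is at most that at [p s / 2], so it cannot exceed
     [(n + 1) * zeta s] while the latter is below [n * zeta s]. *)
  - apply: filterS zeta_gt0 => s z0; rewrite /purchase /sale.
    case: ifPn => [gt|_]; last by left.
    case: ifPn => [lt|_]; last by right.
    have := lt_trans (lt_le_trans gt _) lt; rewrite lte_fin.
    have -> : (n%:R + 1) * zeta s < n%:R * zeta s = false.
      by apply/negbTE; rewrite -leNgt ler_pM2r // lerDl.
    move=> h; exfalso; suff: false by []; apply: h.
    apply: (marginal_le (hV s)); first by rewrite divr_ge0.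
    have : 0 <= Lambda s / k.+1%:R by rewrite divr_ge0.
    by move: (Lambda s / _) (p_ge0 s) => x p0 x0; lra.
  - exact: buyer_gain.
  - exact: seller_gain.
(* Outside a null set no [k] allows a purchase, which bounds the marginal utility at
   [p s + Lambda s / k.+1%:R] for all [k]. Right-continuity carries the bound to [p s], even if
   [p s = 0]. *)
have marginal_bound :
    {ae mu, forall s, (marginal (V^~ s) (p s) <= ((n%:R + 1) * zeta s)%:E)%E}.
  apply: filterS3 zeta_gt0 Lambda_gt0 (ae_foralln buy0) => s z0 L0 buy.
  apply: (lee_cvg_to (marginal_right_continuous (hV s) (p_ge0 s)) (cvg_cst _)).
  near=> y.
  have py : p s < y by near: y; apply: nbhs_right_gt.
  have [k Lk] : exists k : nat, Lambda s / k.+1%:R < y - p s.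
    exists (Num.bound (Lambda s / (y - p s))).
    rewrite ltr_pdivrMr // mulrC -ltr_pdivrMr ?subr_gt0 //.
    apply: lt_trans (archi_boundP _) _; last by rewrite ltr_nat.
    by rewrite divr_ge0 ?subr_ge0 ?(ltW py).
  have := buy k; rewrite /purchase; case: ifPn => [_ /eqP|].
    by rewrite mulf_eq0 (gt_eqF z0) mulf_eq0 (gt_eqF L0) invr_eq0 pnatr_eq0.
  rewrite -leNgt => le _; apply: le_trans le; apply: (marginal_le (hV s)).
    by rewrite addr_ge0 // divr_ge0.
  by rewrite -lerBrDl ltW.
have iL : mu.-integrable setT (fun s => (zeta s * Lambda s)%:E).
  by apply: integrable_value => //; apply: nearW => s; rewrite lexx L_ge0.
have iB := integrableZl measurableT (n%:R + 1) iL.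
apply: (ae_le_integrable _ iB).
  apply: emeasurable_funM; first exact: measurable_marginal.
  exact/measurable_EFinP.
apply: filterS2 marginal_bound zeta_gt0 => s bound z0.
rewrite gee0_abs; last by rewrite mule_ge0 ?lee_fin // ltW // (marginal_gt0 (hV s)).
apply: le_trans (lee_abs _); rewrite -EFinM mulrA EFinM.
by apply: lee_wpmul2r => //; rewrite lee_fin.
Unshelve. all: by end_near. Qed.

End Necessity.

(** * The characterization of existence *)

Theorem theorem1 (R : realType) (d : measure_display) (S : measurableType d)
    (mu : {sigma_finite_measure set S -> \bar R})
    (M : nat) (M_gt0 : (0 < M)%N)
    (U : 'I_M -> R -> S -> \bar R)
    (Lambda : S -> R) (alpha0 : 'I_M -> S -> R)
    (U_field : forall m, utility_field (U m))
    (Lambda_L0 : L0plus Lambda)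
    (Lambda_gt0 : {ae mu, forall s, 0 < Lambda s})
    (alpha0_alloc : allocation mu Lambda alpha0)
    (alpha0_neq0 : forall m, ~ {ae mu, forall s, alpha0 m s = 0}) :
  (exists (zeta : S -> R) (alpha1 : 'I_M -> S -> R),
     arrow_debreu_equilibrium mu U Lambda alpha0 zeta alpha1) <->
  (exists alpha : 'I_M -> S -> R,
     allocation mu Lambda alpha /\
     forall m, (mean mu (fun s =>
       `|U m (alpha m s) s| + marginal (U m ^~ s) (alpha m s) * (Lambda s)%:E)
         < +oo)%E).
Proof.
split=> [[zeta [alpha1 eq]]|[alpha [alloc fin]]]; last first.
  exact: (equilibrium_exists U_field Lambda_L0 Lambda_gt0 M_gt0 alpha0_alloc
    alpha0_neq0 alloc fin).
have [alpha1_L0 alpha1_sum] := ade_allocation eq.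
exists alpha1; split; first exact: ade_allocation eq.
move=> m; apply/(sufficiency_integrable mu U_field Lambda_L0 m (alpha1_L0 m)).
have iU : mu.-integrable setT (fun s => U m (alpha1 m s) s).
  have mU := measurable_utility (U_field m) (alpha1_L0 m).
  apply/integrableP; split=> //.
  exact: (ade_finite_utility eq m).
split=> //; apply: (integrable_marginal_Lambda (U_field m) (ade_measurable eq)
  (ade_positive eq) (alpha0_alloc.1 m) Lambda_L0 Lambda_gt0 _ (alpha0_neq0 m)
  (ade_finite_price eq) iU (ade_optimal eq m)).
apply: filterS alpha1_sum => s <-; rewrite (bigD1 m) //= lerDl sumr_ge0 // => i _.
by have [_] := alpha1_L0 i.
Qed.
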